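(* Under the standing assumptions in the context, the stochastic dominance-constrained problem $$\sup\{R(\pi,\nu) : (\pi,\nu)\in\Delta\}$$ is equivalent to the linear program $$\begin{aligned}\max\quad & \langle\mu,r\rangle\\ \text{s.t.}\quad & L_0\mu=0,\quad \langle\mu,1\rangle=1,\quad L_1\mu\ge y,\\ & \mu\in\mathcal M_w(K),\ \mu\ge 0.\end{aligned}$$ That is: both problems have the same optimal value $\rho^*$ and both attain it; for every feasible $\mu$ of the linear program, with disintegration $\mu=\hat\mu\cdot\phi$, $\phi\in\Phi$, the pair $(\phi,\hat\mu)$ belongs to $\Delta$ and $R(\phi,\hat\mu)=\langle\mu,r\rangle$; in particular, an optimal $\mu^*=\hat\mu^*\cdot\phi^*$ of the linear program yields an optimal pair $(\phi^*,\hat\mu^* )$ of the dominance-constrained problem.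
   Context: **MDP setting.** $S$ and $A$ are Borel spaces (Borel subsets of complete separable metric spaces). For each $s\in S$, $A(s)\in\mathcal B(A)$ is the set of feasible actions; $K=\{(s,a)\in S\times A: a\in A(s)\}$ is closed in $S\times A$. $Q(\cdot\mid s,a)$ is a transition law (stochastic kernel on $S$ given $K$); $r,z:K\to\mathbb R$ are measurable. $\mathcal P(\cdot)$ denotes Borel probability measures. With $H_0=S$, $H_t=K^t\times S$, $\Pi$ is the set of history-dependent randomized policies $\pi=(\pi_t)_{t\ge0}$, $\pi_t$ a stochastic kernel on $A$ given $H_t$ concentrated on $A(s_t)$. $\Phi\subset\Pi$ is the set of stationary randomized Markov policies: stochastic kernels $\phi(\cdot\mid s)$ on $A$ given $S$ with $\phi(A(s)\mid s)=1$. A policy $\pi$ and $\nu\in\mathcal P(S)$ determine a law $P_\nu^\pi$ (expectation $\mathbb E_\nu^\pi$) of the process $(s_t,a_t)_{t\ge0}$ with $s_0\sim\nu$. **Dominance constraint.** $(x)_-=\min\{x,0\}$. $Y$ is a real random variable with support in a compact interval $[a,b]$, and $y(\eta)=\mathbb E[(Y-\eta)_-]$, $\eta\in[a,b]$. Put $$R(\pi,\nu)=\liminf_{T\to\infty}\tfrac1T\mathbb E_\nu^\pi\Big[\sum_{t=0}^{T-1}r(s_t,a_t)\Big],\qquad Z_\eta(\pi,\nu)=\liminf_{T\to\infty}\tfrac1T\mathbb E_\nu^\pi\Big[\sum_{t=0}^{T-1}(z(s_t,a_t)-\eta)_-\Big],$$ $\Delta=\{(\pi,\nu)\in\Pi\times\mathcal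 P(S): R(\pi,\nu)>-\infty,\ Z_\eta(\pi,\nu)\ge y(\eta)\ \forall\eta\in[a,b]\}$, $\rho^*=\sup\{R(\pi,\nu):(\pi,\nu)\in\Delta\}$. **Measures.** For a measure $\mu$ on $K$, $\hat\mu(B)=\mu(\{(s,a)\in K: s\in B\})$ is its marginal on $S$, and $\langle\mu,f\rangle=\int_K f\,d\mu$. Every $\mu\in\mathcal P(K)$ disintegrates as $\mu=\hat\mu\cdot\phi$, i.e. $\mu(B\times C)=\int_B\phi(C\mid s)\hat\mu(ds)$, with $\phi\in\Phi$. Let $w(s,a)=1-r(s,a)$ on $K$ and $\hat w(s)=1-\sup_{a\in A(s)}r(s,a)$ on $S$. $\mathcal M_w(K)$ is the space of signed Borel measures on $K$ with $\int_K w\,d|\mu|<\infty$; $\mathcal M_{\hat w}(S)$ is defined analogously. $\mathcal F_w(K)$ is the space of measurable $h:K\to\mathbb R$ with $\sup_K|h|/w<\infty$. $L_0:\mathcal M_w(K)\to\mathcal M_{\hat w}(S)$, $[L_0\mu](B)=\hat\mu(B)-\int_K Q(B\mid s,a)\,\mu(d(s,a))$. $L_1:\mathcal M_w(K)\to\mathcal C([a,b])$, $[L_1\mu](\eta)=\langle\mu,(z-\eta)_-\rangle$. $L_1\mu\ge y$ means pointwise on $[a,b]$. **Standing assumptions.** (1) $\Delta\ne\emptyset$. (2) $r\le0$ and for every $\epsilon\ge0$ the set $\{(s,a)\in K: r(s,a)\ge-\epsilon\}$ is compact. (3) $z$ is bounded and upper semicontinuous on $K$. (4) $Q$ is weakly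 continuous: $(s,a)\mapsto\int_S h(\xi)Q(d\xi\mid s,a)$ is continuous and bounded on $K$ for every bounded continuous $h$ on $S$. (5) $(z-\eta)_-\in\mathcal F_w(K)$ for all $\eta\in[a,b]$. (6) $(s,a)\mapsto\int_S\hat w(\xi)Q(d\xi\mid s,a)$ is in $\mathcal F_w(K)$. *)

(* Defs.v *)
From HB Require Import structures.
From mathcomp Require Import all_boot all_order all_algebra.
From mathcomp Require Import all_classical all_reals all_analysis.
From mathcomp Require Import measurable_realfun.

Set Implicit Arguments.
Unset Strict Implicit.
Unset Printing Implicit Defensive.
Import Order.TTheory GRing.Theory Num.Theory.
Import numFieldNormedType.Exports.
Local Open Scope classical_set_scope.
Local Open Scope ring_scope.
Local Open Scope ereal_scope.

(** The carrier of [T] equipped with its Borel sigma-algebra. *)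
Notation borel T := (g_sigma_algebraType (@open T)).

(** [T] is (homeomorphic to) a Borel subset of a complete separable metric
    space; a Hausdorff pseudometric space is a metric space. *)
Definition borel_space (R : realType) (T : topologicalType) : Prop :=
  exists (X : completePseudoMetricType R) (i : T -> X),
    [/\ hausdorff_space X,
        exists2 D : set X, countable D & dense D,
        injective i,
        forall U : set T, open U <-> exists2 V : set X, open V & U = i @^-1` V
      & <<s @open X >> (range i)].

Section measure_bind.
Context d d' (X : measurableType d) (Y : measurableType d') (R : realType).
Variables (m : {measure set X -> \bar R}) (k : R.-ker X ~> Y).

Definition mbind (U : set Y) : \bar R := \int[m]_x k x U.

Let mbind0 : mbind set0 = 0.
Proof.
by rewrite /mbind (eq_integral (cst 0)) ?integral0// => x _; rewrite measure0.
Qed.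

Let mbind_ge0 U : 0 <= mbind U. Proof. exact: integral_ge0. Qed.

Let mbind_sigma_additive : semi_sigma_additive mbind.
Proof.
move=> U mU tU mUU; rewrite [X in _ --> X](_ : _ =
  \int[m]_x (\sum_(n <oo) k x (U n))); last first.
  apply: eq_integral => V _.
  by apply/esym/cvg_lim => //; exact/measure_semi_sigma_additive.
apply/cvg_closeP; split.
  by apply: is_cvg_nneseries => n _ _; exact: integral_ge0.
rewrite closeE// integral_nneseries// => n.
exact: (measurable_kernel k _ (mU n)).
Qed.

HB.instance Definition _ :=
  isMeasure.Build _ _ _ mbind mbind0 mbind_ge0 mbind_sigma_additive.

End measure_bind.

Section kernel_precomposition.
Context d d' d'' (X : measurableType d) (Y : measurableType d')
  (Z : measurableType d'') (R : realType).
Variables (f : X -> Y) (mf : measurable_fun setT f) (k : R.-pker Y ~> Z).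

Definition kprecomp of measurable_fun setT f : X -> {measure set Z -> \bar R} :=
  fun x => k (f x).

Let measurable_kprecomp U : measurable U ->
  measurable_fun [set: X] (kprecomp mf ^~ U).
Proof.
by move=> mU; exact: (measurableT_comp (measurable_kernel k U mU) mf).
Qed.

HB.instance Definition _ :=
  isKernel.Build _ _ _ _ _ (kprecomp mf) measurable_kprecomp.

Let kprecomp_prob x : kprecomp mf x [set: Z] = 1.
Proof. exact: prob_kernel. Qed.

HB.instance Definition _ :=
  Kernel_isProbability.Build _ _ _ _ _ (kprecomp mf) kprecomp_prob.

End kernel_precomposition.

Section signed_measures.
Context d (T : measurableType d) (R : realType).
Implicit Type mu : {charge set T -> \bar R}.

Lemma hahn_sig mu : {PN : set T * set T | hahn_decomposition mu PN.1 PN.2}.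
Proof.
have [P /cid[N PN]] := cid (Hahn_decomposition mu).
by exists (P, N).
Qed.

(** The choice of the Hahn decomposition is immaterial
    ([Hahn_decomposition_uniq]). *)
Definition cpos mu : {measure set T -> \bar R} := jordan_pos (svalP (hahn_sig mu)).
Definition cneg mu : {measure set T -> \bar R} := jordan_neg (svalP (hahn_sig mu)).
Definition cvariation mu : {measure set T -> \bar R} :=
  charge_variation (svalP (hahn_sig mu)).

Definition cintegral mu (D : set T) (f : T -> \bar R) : \bar R :=
  \int[cpos mu]_(x in D) f x - \int[cneg mu]_(x in D) f x.

End signed_measures.

(** Functions and kernels "on [K]" are total functions and kernels on [S * A];
    only their values on the closed set [K] are ever constrained or used, and
    any measurable function or stochastic kernel on [K] extends to [S * A].
    Likewise a measure on [K] is a measure on [S * A] that does not charge the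
    complement of [K]. *)
Section MDP.
Context (R : realType) (S A : ptopologicalType).
Variable feas : S -> set A.

Definition graph : set (S * A) := [set x | feas x.1 x.2].
Local Notation K := graph.
Local Notation SA := (borel S * borel A)%type.

(** Histories [((s_0, a_0), ..., (s_(t-1), a_(t-1))), s_t)]; the space
    [H_t = K^t * S] is the subset [histories t]. *)
Local Notation H t := (t.-tuple SA * borel S)%type.

Definition histories t : set (H t) :=
  [set h | forall i : 'I_t, K (tnth h.1 i)].

Definition policy (pi : forall t, R.-pker H t ~> borel A) : Prop :=
  forall t (h : H t), histories h -> pi t h (feas h.2) = 1.

Definition stationary_policy (phi : R.-pker borel S ~> borel A) : Prop :=
  forall s, phi s (feas s) = 1.

Definition policy_of_stationary (phi : R.-pker borel S ~> borel A) t :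
    R.-pker H t ~> borel A :=
  kprecomp phi (@measurable_snd _ _ (t.-tuple SA) (borel S)).

Section law.
Variable Q : R.-pker SA ~> borel S.

Definition hist0 (s : borel S) : H 0 := ([tuple], s).

Definition histS t (x : H t * borel A * borel S) : H t.+1 :=
  ([tuple of rcons x.1.1.1 (x.1.1.2, x.1.2)], x.2).

Definition last_pair t (x : H t * borel A) : SA := (x.1.2, x.2).

Lemma measurable_hist0 : measurable_fun setT hist0.
Proof.
apply/measurable_fun_pairP; split; last exact: measurable_id.
by apply/measurable_fun_tnthP => -[].
Qed.

Lemma measurable_last_pair t : measurable_fun setT (@last_pair t).
Proof.
apply/measurable_fun_pairP; split; last exact: measurable_snd.
exact: (measurableT_comp measurable_snd measurable_fst).
Qed.

Lemma measurable_histS t : measurable_fun setT (@histS t).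
Proof.
apply/measurable_fun_pairP; split; last exact: measurable_snd.
apply/measurable_fun_tnthP => i.
have [it|ti] := ltnP i t.
  rewrite (_ : _ \o _ = (fun x : H t * borel A * borel S =>
    tnth x.1.1.1 (Ordinal it))).
    apply: (measurableT_comp (measurable_tnth (Ordinal it))).
    apply: (measurableT_comp measurable_fst).
    exact: (measurableT_comp measurable_fst measurable_fst).
  apply/funext => x /=.
  by rewrite !(tnth_nth (x.1.1.2, x.1.2)) /= nth_rcons size_tuple it.
rewrite (_ : _ \o _ = (@last_pair t \o fst)).
  exact: (measurableT_comp (@measurable_last_pair t) measurable_fst).
apply/funext => x /=.
have /eqP it : (i : nat) == t by rewrite eqn_leq ti -ltnS ltn_ord.
by rewrite (tnth_nth (x.1.1.2, x.1.2)) /= nth_rcons size_tuple it ltnn eqxx.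
Qed.

(** Given the history [h] at time [t], draw [a ~ pi t h], then
    [s' ~ Q (s_t, a)], and append both to [h]. *)
Definition hist_step (pi : forall t, R.-pker H t ~> borel A) t :
    R.-ker H t ~> H t.+1 :=
  pi t \; (kprecomp Q (@measurable_last_pair t) \; kdirac (@measurable_histS t)).

(** The image of the law [P_nu^pi] of the process under
    [(s_0, a_0, ..., s_(t-1), a_(t-1), s_t)]; the optimality and dominance
    criteria involve [P_nu^pi] only through these images. *)
Fixpoint hist_law pi (nu : {measure set (borel S) -> \bar R}) t :
    {measure set (H t) -> \bar R} :=
  if t is t'.+1 then mbind (hist_law pi nu t') (hist_step pi t')
  else mbind nu (kdirac measurable_hist0).

(** [E_nu^pi [\sum_(t < T) f (s_t, a_t)]]. *)
Definition expected_total (f : S * A -> R) pi nu T : \bar R :=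
  \int[hist_law pi nu T]_(h in @histories T)
    (\sum_(t < T) f (tnth h.1 t))%R%:E.

Definition average (f : S * A -> R) pi nu : \bar R :=
  limn_einf (fun T => (T%:R^-1)%:E * expected_total f pi nu T).

End law.

(** [(x - eta)_-], where [(x)_- = min(x, 0)]. *)
Definition shortfall (x eta : R) : R := (Num.min (x - eta) 0)%R.

(** [y(eta) = E[(Y - eta)_-]]. *)
Definition benchmark d (Omega : measurableType d) (P : probability Omega R)
    (Y : Omega -> R) (eta : R) : \bar R :=
  'E_P[fun omega => shortfall (Y omega) eta].

Section problems.
Variables (Q : R.-pker SA ~> borel S) (r z : S * A -> R).
Variables (a b : R) (y : R -> \bar R).

Definition Delta (pi : forall t, R.-pker H t ~> borel A)
    (nu : probability (borel S) R) : Prop :=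
  [/\ policy pi, -oo < average Q r pi nu
    & forall eta, (a <= eta <= b)%R ->
        y eta <= average Q (fun x => shortfall (z x) eta) pi nu].

Definition rho_star : \bar R :=
  ereal_sup [set v | exists pi nu, Delta pi nu /\ v = average Q r pi nu].

Definition w (x : S * A) : R := (1 - r x)%R.

Definition w_hat (s : S) : R := (1 - sup [set r (s, a') | a' in feas s])%R.

(** The bound forces [h] to be real-valued on [K]. *)
Definition F_w (h : SA -> \bar R) : Prop :=
  measurable_fun (K : set SA) h /\
  exists C : R, forall x, K x -> `|h x| <= (C * w x)%:E.

(** Signed Borel measures on [K] with [\int_K w d|mu| < oo]. *)
Definition M_w (mu : {charge set SA -> \bar R}) : Prop :=
  cvariation mu (~` K) = 0 /\ \int[cvariation mu]_(x in K) (w x)%:E < +oo.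

Definition pairing (mu : {charge set SA -> \bar R}) (h : SA -> \bar R) : \bar R :=
  cintegral mu K h.

Definition marginal (mu : {charge set SA -> \bar R}) (B : set S) : \bar R :=
  mu (K `&` [set x | B x.1]).

Definition L0 (mu : {charge set SA -> \bar R}) (B : set (borel S)) : \bar R :=
  marginal mu B - pairing mu (fun x => Q x B).

Definition L1 (mu : {charge set SA -> \bar R}) (eta : R) : \bar R :=
  pairing mu (fun x => (shortfall (z x) eta)%:E).

Definition lp_feasible (mu : {charge set SA -> \bar R}) : Prop :=
  M_w mu /\
  [/\ forall B : set (borel S), measurable B -> L0 mu B = 0,
      pairing mu (cst 1) = 1,
      forall eta, (a <= eta <= b)%R -> y eta <= L1 mu eta
    & forall B : set SA, measurable B -> 0 <= mu B].

Definition lp_objective (mu : {charge set SA -> \bar R}) : \bar R :=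
  pairing mu (EFin \o r).

Definition lp_value : \bar R :=
  ereal_sup [set lp_objective mu | mu in lp_feasible].

Definition lp_optimal (mu : {charge set SA -> \bar R}) : Prop :=
  lp_feasible mu /\
  forall mu', lp_feasible mu' -> lp_objective mu' <= lp_objective mu.

Definition sd_optimal pi nu : Prop :=
  Delta pi nu /\
  forall pi' nu', Delta pi' nu' -> average Q r pi' nu' <= average Q r pi nu.

(** [mu = nu . phi], where [nu] is the marginal of [mu] and [phi] is a
    stationary randomized Markov policy. *)
Definition disintegration (mu : {charge set SA -> \bar R})
    (nu : probability (borel S) R) (phi : R.-pker borel S ~> borel A) : Prop :=
  [/\ stationary_policy phi,
      forall B : set (borel S), measurable B -> nu B = marginal mu B
    & forall (B : set (borel S)) (C : set (borel A)),
        measurable B -> measurable C ->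
        mu (K `&` (B `*` C)) = \int[nu]_(s in B) phi s C].

End problems.

End MDP.

(* Main.v *)
Require Import Defs.
From HB Require Import structures.
From mathcomp Require Import all_boot all_order all_algebra.
From mathcomp Require Import finmap lra.
From mathcomp Require Import all_classical all_reals all_analysis.
From mathcomp Require Import measurable_realfun.
Set Implicit Arguments.
Unset Strict Implicit.
Unset Printing Implicit Defensive.
Import Order.TTheory GRing.Theory Num.Theory.
Import numFieldNormedType.Exports.
Local Open Scope classical_set_scope.
Local Open Scope ring_scope.
Local Open Scope ereal_scope.

(** A policy pair in [Delta] has expected occupation measures
    [mu_T(B) = (1/T) \sum_(t < T) P((s_t, a_t) \in B)], and the [T]-step averages
    of [r] and [(z - eta)_-] are integrals against [mu_T].  Since [-r] has compact
    sublevel sets and eventually bounded averages, these measures are tight, and a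
    limit along an ultrafilter on [nat] is a probability [P] on [K].  Weak
    continuity of [Q] makes [P] invariant, because [mu_T] is invariant up to [1/T];
    the nonnegative costs [-r] and [-(z - eta)_-] are lower semicontinuous on [K],
    so their integrals do not increase in the limit.  Hence [P] is feasible for the
    linear program and its value is at least that of the policy.  The same
    compactness argument applied to a maximizing sequence of feasible measures
    gives attainment.

    Conversely a feasible [mu] disintegrates as [nu . phi]; started from [nu], the
    stationary policy [phi] gives [(s_t, a_t)] the law [mu] at every time, so that
    all averages are constant and equal to the integrals against [mu]. *)

(** * Borel spaces *)

(** The limit of [mu_T(B)] along an ultrafilter exists for every measurable [B], but it is only
    finitely additive in [B]. Its values on compact sets are therefore regularized into a measure,
    at the price of equality: what survives is [P G <= lim mu_T(G)] for open [G], together with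
    total mass 1, which comes from tightness. The argument is arranged around this one-sided
    estimate. It bounds from above the integral of a nonnegative cost with closed sublevel sets, and
    every property of the limit is put in that form. Even the invariance of [P] is first an
    inequality for each continuous [h] with values in [[0, 1]]; it becomes an equality because
    [1 - h] is such a function too.

    The disintegration uses of the action space only that it can be coded in the reals by a
    measurable map with a measurable left inverse; no Borel isomorphism is constructed. *)

Lemma dense_sequence (X : topologicalType) (D : set X) (x0 : X) :
  countable D -> dense D ->
  exists e : nat -> X, forall O : set X, open O -> O !=set0 -> exists k, O (e k).
Proof.
move=> /countable_injP[f fi] dD.
exists (fun k => xget x0 [set x | D x /\ f x = k]) => O oO O0.
have [x [Ox Dx]] := dD O O0 oO.
exists (f x); case: xgetP => [y _ [Dy fyx]|/(_ x)[]//].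
by have -> : y = x by apply: fi; rewrite ?inE.
Qed.

(** The two radii leave room for a limit: if a sequence is eventually in the ball of radius
    [1/(m+1)], its limit lies in the concentric ball of twice that radius, hence in [V]. The
    interior appears because a ball of a pseudometric structure need not be open. *)
Lemma dense_ball_base (R : realType) (X : pseudoMetricType R) (e : nat -> X)
    (eP : forall O : set X, open O -> O !=set0 -> exists k, O (e k))
    (V : set X) (x : X) : open V -> V x ->
  exists k m, (ball (e k) (m.+1%:R^-1 : R))° x /\
    ball (e k) (m.+1%:R^-1 + m.+1%:R^-1 : R)%R `<=` V.
Proof.
move=> oV Vx.
have : nbhs x V by exact: open_nbhs_nbhs.
rewrite nbhs_ballP => -[r /= r0 rV].
(* A point of the large ball is within [q + 2q] of [x], whence the third of [r]. *)
have [m _ mP] := @near_infty_natSinv_lt R (PosNum (divr_gt0 r0 (ltr0Sn R 2))).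
have h : (m.+1%:R^-1 < r / 3)%R := mP m (leqnn m).
set q : R := (m.+1%:R^-1)%R in h *.
have q0 : (0 < q)%R by rewrite invr_gt0.
have q3 : (q + (q + q) <= r)%R.
  rewrite (le_trans (lerD (ltW h) (lerD (ltW h) (ltW h))))//.
  by rewrite -!mulr2n -mulrS -[leLHS]mulr_natr divfK.
have [k ek] := eP (ball x (q / 2 : R))° (@open_interior _ _)
  (ex_intro _ x (nbhsx_ballx _ _ (divr_gt0 q0 (ltr0Sn R 1)))).
have {}ek := interior_subset ek.
exists k, m; split => /=.
  rewrite /interior nbhs_ballP; exists (q / 2)%R => /=; first exact: divr_gt0.
  by move=> y; apply: ball_split; exact: ball_sym.
move=> y yk; apply: rV; apply: le_ball q3 _ _.
apply: ball_triangle yk; apply: le_ball ek.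
by rewrite ler_pdivrMr// ler_peMr ?ltW// ltr1n.
Qed.

Lemma closure_preimage_sub (T U : topologicalType) (f : T -> U) (B : set U) :
  continuous f -> closure (f @^-1` B) `<=` f @^-1` closure B.
Proof.
move=> cf x clx V Vfx; have [y [By Vy]] := clx _ (cf x _ Vfx).
by exists (f y).
Qed.

Lemma hausdorff_prod (S A : topologicalType) :
  hausdorff_space S -> hausdorff_space A -> hausdorff_space (S * A)%type.
Proof.
move=> hS hA [s a] [s' a'] cl; congr pair.
- apply: hS => B C Bs Cs'.
  have [||[x y] [/= [] Bx _ [Cx _]]] := cl (B `*` setT) (C `*` setT).
  + by exists (B, setT) => //; split => //; exact: filterT.
  + by exists (C, setT) => //; split => //; exact: filterT.
  by exists x.
- apply: hA => B C Bs Cs'.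
  have [||[x y] [/= [] _ Bx [_ Cx]]] := cl (setT `*` B) (setT `*` C).
  + by exists (setT, B) => //; split => //; exact: filterT.
  + by exists (setT, C) => //; split => //; exact: filterT.
  by exists y.
Qed.

Lemma regular_prod (S A : topologicalType) :
  regular_space S -> regular_space A -> regular_space (S * A)%type.
Proof.
move=> rS rA [s a] W [[B C] [/= Bs Ca] BCW].
have [B' B's B'B] := rS s B Bs; have [C' C'a C'C] := rA a C Ca.
exists (B' `*` C').
  by exists (B', C').
move=> [x y] cl; apply: BCW; split => /=.
- apply: B'B; apply: (@closure_preimage_sub _ _ fst B' _ (x, y)).
    by move=> ?; exact: cvg_fst.
  by apply: closureS cl => z [].
- apply: C'C; apply: (@closure_preimage_sub _ _ snd C' _ (x, y)).
    by move=> ?; exact: cvg_snd.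
  by apply: closureS cl => z [].
Qed.

Lemma measurable_fun_borel d (X : measurableType d) (T : ptopologicalType)
    (f : X -> borel T) :
  (forall V : set T, open V -> measurable (f @^-1` V)) ->
  measurable_fun setT f.
Proof.
move=> fV; apply: (@measurability _ _ _ _ setT f (@open T)) => //.
by move=> _ [V oV <-]; rewrite setTI; exact: fV.
Qed.

Section borel_space_theory.
Context (R : realType) (T : ptopologicalType).
Hypothesis bT : borel_space R T.

Lemma borel_space_hausdorff : hausdorff_space T.
Proof.
have [X [i [hX _ ii oT _]]] := bT.
move=> x y cl; apply: ii; apply: hX => B C.
rewrite !nbhsE => -[B' [oB' B'x] B'B] [C' [oC' C'x] C'C].
have [||z [Bz Cz]] := cl (i @^-1` B') (i @^-1` C').
- by apply: open_nbhs_nbhs; split => //; apply/oT; exists B'.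
- by apply: open_nbhs_nbhs; split => //; apply/oT; exists C'.
by exists (i z); split; [exact: B'B|exact: C'C].
Qed.

Lemma borel_space_regular : regular_space T.
Proof.
have [X [i [hX _ ii oT _]]] := bT.
have ci : continuous i by apply/continuousP => V oV; apply/oT; exists V.
move=> a U aU.
have [U' [/oT[V oV U'V] U'a] U'U] : exists2 B, open_nbhs a B & B `<=` U.
  by rewrite nbhsE in aU.
have Via : nbhs (i a) V by apply: open_nbhs_nbhs; split => //; rewrite U'V in U'a.
have [W Wa WV] := @urysohn.uniform_regular X (i a) V Via.
exists (i @^-1` W); first exact: (ci a W Wa).
apply: subset_trans U'U; rewrite U'V.
by apply: subset_trans (closure_preimage_sub ci) _ => x /WV.
Qed.

Lemma borel_space_countable_base : exists b : nat * nat -> set T,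
  (forall n, open (b n)) /\
  forall U x, open U -> U x -> exists n, b n x /\ b n `<=` U.
Proof.
have [X [i [hX [D cD dD] ii oT _]]] := bT.
have [e eP] := dense_sequence (i point) cD dD.
pose b (n : nat * nat) := i @^-1` (ball (e n.1) (n.2.+1%:R^-1 : R))°.
exists b; split.
  by move=> n; apply/oT; exists (ball (e n.1) (n.2.+1%:R^-1 : R))°; [exact: open_interior|].
move=> U x /oT[V oV ->] Vx.
have [k [m [xb bV]]] := dense_ball_base eP oV Vx.
exists (k, m); split => // y /interior_subset/= yk; apply: bV.
by apply: le_ball yk; rewrite lerDl invr_ge0.
Qed.

(** [F] is the trace of a closed set of the ambient metric space. [h n] is 1 on that set and 0 on
    the points with no point of it within [1/(n+1)]; any point off [F] is of the second kind for
    large [n]. Urysohn functions come with no monotonicity in [n], so the later passage to the limit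
    is by domination. *)
Lemma closed_approx (F : set T) : closed F ->
  exists h : nat -> T -> R, [/\ forall n, continuous (h n),
    forall n x, (0 <= h n x <= 1)%R & forall x, h n x @[n --> \oo] --> (\1_F x : R)].
Proof.
have [X [i [hX _ ii oT _]]] := bT.
have ci : continuous i by apply/continuousP => V oV; apply/oT; exists V.
move=> /closed_openC/oT[V oV FV].
pose B n := [set x | forall a, (~` V) a -> ~ ball a (n.+1%:R^-1 : R) x].
have us n : uniform_separator (~` V) (B n).
  apply: uniform_separatorW; exists [set xy | ball xy.1 (n.+1%:R^-1 : R) xy.2].
    by apply: entourage_ball (PosNum _); rewrite invr_gt0.
  rewrite -subset0 => -[x y] [[/= Vx By]] xy; exact: By xy.
exists (fun n x => 1 - Urysohn (~` V) (B n) (i x))%R; split.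
- move=> n x; apply: cvgB; first exact: cvg_cst.
  by apply: continuous_comp; [exact: ci|exact: Urysohn_continuous].
- move=> n x; have := @Urysohn_range X R (~` V) (B n) _ (imageT _ (i x)).
  by rewrite /= in_itv /= => /andP[? ?]; apply/andP; split; lra.
- move=> x; have [Fx|nFx] := pselect (F x).
    rewrite indicE mem_set//=.
    have Vix : (~` V) (i x) by move=> Vix; have : (~` F) x by rewrite FV.
    under eq_fun do rewrite (Urysohn_sub0 (us _) (imageP _ Vix)) subr0.
    exact: cvg_cst.
  rewrite indicE memNset//=.
  have Vix : V (i x) by have : (~` F) x by []; rewrite FV.
  apply: cvg_near_cst.
  have : nbhs (i x) V by exact: open_nbhs_nbhs.
  rewrite nbhs_ballP => -[r /= r0 rV].
  have [m _ mP] := @near_infty_natSinv_lt R (PosNum r0).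
  exists m => // n /= mn.
  have Bn : B n (i x).
    move=> a Va ba; apply: Va; apply: rV; apply: ball_sym.
    by apply: le_ball ba; exact/ltW/mP.
  by rewrite (Urysohn_sub1 (us n) (imageP _ Bn)) subrr.
Qed.

End borel_space_theory.

(** In general the Borel sets of a product may exceed the product of the Borel sigma-algebras. With
    countable bases every open set is a countable union of open rectangles. *)
Lemma open_prod_measurable (R : realType) (S A : ptopologicalType) :
  borel_space R S -> borel_space R A ->
  forall V : set (S * A), open V -> measurable (V : set (borel S * borel A)).
Proof.
move=> /borel_space_countable_base[b [ob bP]] /borel_space_countable_base[c [oc cP]].
move=> V oV.
rewrite (_ : (V : set (borel S * borel A)) = \bigcup_(n in [set n | b n.1 `*` c n.2 `<=` V])
  ((b n.1 : set (borel S)) `*` (c n.2 : set (borel A)))).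
  rewrite bigcup_mkcond; apply: countable_bigcupT_measurable => // n.
  by case: ifPn => // _; apply: measurableX; exact: sub_sigma_algebra.
apply/seteqP; split => [[s a] Vsa|x [n /= bV]]; last exact: bV.
have [[B C] [/= Bs Ca] BCV] : nbhs (s, a) V by exact: open_nbhs_nbhs.
move: Bs Ca; rewrite !nbhsE => -[B' [oB' B's] B'B] [C' [oC' C'a] C'C].
have [n [bs bB]] := bP _ _ oB' B's; have [m [ca cC]] := cP _ _ oC' C'a.
exists (n, m) => //= -[x y] [/= bx cy]; apply: BCV; split => /=.
  exact/B'B/bB.
exact/C'C/cC.
Qed.

Section borel_measure_eq.
Context (R : realType) (T : ptopologicalType).
Hypothesis bT : borel_space R T.

Lemma continuous_borel (h : T -> R) : continuous h ->
  measurable_fun [set: borel T] h.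
Proof.
move=> /continuousP ch; apply: (measurability _ (RGenOpens.measurableE R)).
move=> _ [_ [x [y ->]] <-]; rewrite setTI; apply: sub_sigma_algebra.
exact/ch/interval_open.
Qed.

(** Closed sets generate the Borel sets and are stable under intersection, so it suffices to reach
    their indicators as bounded limits of continuous functions. *)
Lemma borel_probability_eq (m1 m2 : {measure set (borel T) -> \bar R}) :
  m1 setT = 1 -> m2 setT = 1 ->
  (forall h : T -> R, continuous h -> (forall x, 0 <= h x <= 1)%R ->
    \int[m1]_x (h x)%:E = \int[m2]_x (h x)%:E) ->
  forall B, measurable B -> m1 B = m2 B.
Proof.
move=> m11 m21 m12.
have closedE (F : set T) : closed F -> m1 F = m2 F.
  move=> cF; have [h [ch h01 hF]] := closed_approx bT cF.
  have mF : measurable (F : set (borel T)).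
    rewrite -(setCK F); apply: measurableC; apply: sub_sigma_algebra.
    exact: closed_openC.
  have lim (m : {measure set (borel T) -> \bar R}) : m setT = 1 ->
      \int[m]_x (h n x)%:E @[n --> \oo] --> m F.
    move=> mT.
    rewrite (_ : m F = \int[m]_x (\1_F x)%:E); last first.
      by rewrite integral_indic// setIT.
    have [] := @dominated_convergence _ _ _ m setT measurableT
      (fun n x => (h n x)%:E) (fun x => (\1_F x)%:E) (cst 1) => //.
    - by move=> n; apply/measurable_EFinP; exact: continuous_borel.
    - by apply/measurable_EFinP; exact: measurable_indic.
    - by apply: aeW => x _; apply: cvg_EFin; [exact: nearW|exact: hF].
    - apply/integrableP; split; first exact: measurable_cst.
      by rewrite integral_cst// mT mule1 /= normr1 ltry.
    - apply: aeW => x n _ /=; rewrite lee_fin ger0_norm; by have /andP[] := h01 n x.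
  have l1 := lim _ m11; have l2 := lim _ m21.
  apply: (cvg_unique _ l1); first exact: ereal_hausdorff.
  by rewrite (_ : (fun n => _) = (fun n => \int[m2]_x (h n x)%:E))//; apply/funext => n; exact: m12.
apply: (measure_unique (@closed T : set (set (borel T))) (fun=> setT)) => //.
- apply/seteqP; split.
    apply: smallest_sub; first exact: smallest_sigma_algebra.
    move=> U oU; rewrite -(setCK U); apply: sigma_algebraC.
    by apply: sub_sigma_algebra; exact: open_closedC.
  apply: smallest_sub; first exact: sigma_algebra_measurable.
  move=> F cF; rewrite -(setCK F); apply: measurableC; apply: sub_sigma_algebra.
  exact: closed_openC.
- by move=> F G; exact: closedI.
- by rewrite bigcup_const.
- by move=> _; rewrite [ltLHS]m11 ltry.
Qed.

End borel_measure_eq.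

(** * Limits of tight sequences of measures *)

(** The map [f] lets the measure live on a type with its own sigma-algebra; it will be the identity
    from [S * A] to the product of the two Borel spaces. *)
Lemma caratheodory_pushforward (R : realType) (T : pointedType)
    (mu : {outer_measure set T -> \bar R}) d (M : measurableType d)
    (f : T -> M) :
  (forall B, measurable B -> mu.-caratheodory (f @^-1` B)) ->
  exists m : {measure set M -> \bar R}, forall B, m B = mu (f @^-1` B).
Proof.
move=> mf.
have mf' : measurable_fun [set: caratheodory_type mu] f.
  by move=> _ B mB; rewrite setTI; exact: (mf _ mB).
pose m : {measure set M -> \bar R} :=
  pushforward (mu : {measure set (caratheodory_type mu) -> \bar R}) f.
by exists (m mf').
Qed.

(* The content-to-measure construction of Halmos: a set function on compact sets
   that is additive only on disjoint sets still induces an outer measure for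
   which the open sets are measurable. *)
Section compact_content.
Context (R : realType) (T : ptopologicalType).
Hypothesis (hT : hausdorff_space T) (regT : regular_space T).
Variable lam : set T -> \bar R.
Hypothesis lam0 : lam set0 = 0.
Hypothesis lam_le : forall C D, compact C -> compact D -> C `<=` D ->
  lam C <= lam D.
Hypothesis lamU : forall C D, compact C -> compact D ->
  lam (C `|` D) <= lam C + lam D.
Hypothesis lamUd : forall C D, compact C -> compact D -> C `&` D = set0 ->
  lam C + lam D <= lam (C `|` D).
Hypothesis lam1 : forall C, compact C -> lam C <= 1.

Definition inner_content (G : set T) : \bar R :=
  ereal_sup [set lam C | C in [set C | compact C /\ C `<=` G]].

Definition outer_content (M : set T) : \bar R :=
  ereal_inf [set inner_content G | G in [set G | open G /\ M `<=` G]].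

Lemma le_inner_content C G : compact C -> C `<=` G -> lam C <= inner_content G.
Proof. by move=> cC CG; apply: ereal_sup_ubound; exists C. Qed.

Lemma inner_content_ge0 G : 0 <= inner_content G.
Proof.
by rewrite -lam0 le_inner_content//; exact: compact0.
Qed.

Lemma inner_content_le1 G : inner_content G <= 1.
Proof. by apply: ge_ereal_sup => _ [C [cC _] <-]; exact: lam1. Qed.

Lemma inner_content_le G H : G `<=` H -> inner_content G <= inner_content H.
Proof.
move=> GH; apply: ereal_sup_le => _ [C [cC CG] <-].
by exists C => //; split => //; exact: subset_trans GH.
Qed.

Lemma inner_content_set0 : inner_content set0 = 0.
Proof.
apply/eqP; rewrite eq_le inner_content_ge0 andbT.
by apply: ge_ereal_sup => _ [C [_ CS]] <-; move: CS; rewrite /= subset0 => ->; rewrite lam0.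
Qed.

Lemma lam_bigsetU (C : (set T)^nat) n : (forall i, compact (C i)) ->
  lam (\big[setU/set0]_(i < n) C i) <= \sum_(i < n) lam (C i).
Proof.
move=> cC; elim: n => [|n ih]; first by rewrite !big_ord0 lam0.
rewrite !big_ord_recr/= (le_trans (lamU _ _))//; last exact: leeD.
exact: bigsetU_compact.
Qed.

(** By regularity each point of [C] has a neighbourhood whose closure lies in one of the [G n].
    Finitely many of them cover [C]; grouping their closures by the index [n] splits [C] into
    compact pieces [E n] inside [G n], to which finite subadditivity applies. *)
Lemma inner_content_bigcup (G : (set T)^nat) : (forall n, open (G n)) ->
  inner_content (\bigcup_n G n) <= \sum_(n <oo) inner_content (G n).
Proof.
move=> oG; apply: ge_ereal_sup => _ [C [cC CG] <-].
have /choice[nV nVP] (x : T) : exists nV : nat * set T,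
    C x -> [/\ open nV.2, nV.2 x & closure nV.2 `<=` G nV.1].
  have [Cx|nCx] := pselect (C x); last by exists (0%N, set0).
  have [n _ Gnx] := CG _ Cx.
  have /regT[V] : nbhs x (G n) by exact: open_nbhs_nbhs.
  rewrite /= nbhsE => -[W [oW Wx] WV] VG.
  by exists (n, W) => _; split => //=; exact: subset_trans (closureS WV) VG.
have := cC; rewrite compact_cover => /(_ T C (fun x => (nV x).2)) [].
- by move=> x /nVP[].
- by move=> x Cx; exists x => //; have [] := nVP _ Cx.
move=> D DC CD.
pose E n := C `&` \bigcup_(x in [set` D] `&` [set x | (nV x).1 = n])
  closure (nV x).2.
have cE n : compact (E n).
  apply: compact_closedI => //.
  apply: closed_bigcup => [|i _]; last exact: closed_closure.
  by apply: finite_setIl; exact: finite_fset.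
have EG n : E n `<=` G n.
  move=> x [Cx [y [/= yD <-]]].
  have Cy : C y by have := DC _ yD; rewrite inE.
  by have [_ _] := nVP _ Cy; exact.
have [N DN] : exists N, forall x, x \in D -> ((nV x).1 < N)%N.
  exists (\max_(x <- D) (nV x).1).+1 => x xD; rewrite ltnS.
  by rewrite (big_fsetD1 x)//= leq_maxl.
have CE : C `<=` \big[setU/set0]_(i < N) E i.
  move=> x Cx; have [y /= Dy Vx] := CD _ Cx.
  rewrite -bigcup_mkord; exists (nV y).1; first exact: DN.
  split => //; exists y => //; exact: subset_closure.
apply: (@le_trans _ _ (\sum_(0 <= i < N) inner_content (G i))).
  rewrite big_mkord; apply: le_trans (lam_le cC _ CE) _.
    exact: bigsetU_compact.
  apply: le_trans (lam_bigsetU _ cE) _; apply: lee_sum => i _.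
  exact: le_inner_content.
by apply: nneseries_lim_ge => n _ _; exact: inner_content_ge0.
Qed.

Lemma outer_content_open G : open G -> outer_content G = inner_content G.
Proof.
move=> oG; apply/eqP; rewrite eq_le; apply/andP; split.
  by apply: ereal_inf_lbound; exists G => //; split.
by apply: le_ereal_inf_tmp => _ [H [_ GH] <-]; exact: inner_content_le.
Qed.

Lemma outer_content_ge0 M : 0 <= outer_content M.
Proof. by apply: le_ereal_inf_tmp => _ [G _ <-]; exact: inner_content_ge0. Qed.

Lemma outer_content_le1 M : outer_content M <= 1.
Proof.
apply: (@ge_ereal_inf _ _ _); exists (inner_content setT).
  by exists setT => //; split => //; exact: openT.
exact: inner_content_le1.
Qed.

Lemma outer_content_fin_num M : outer_content M \is a fin_num.
Proof.
by rewrite ge0_fin_numE ?outer_content_ge0// (le_lt_trans (outer_content_le1 _))// ltry.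
Qed.

Lemma outer_content_set0 : outer_content set0 = 0.
Proof. by rewrite outer_content_open ?inner_content_set0//; exact: open0. Qed.

Lemma outer_content_le : {homo outer_content : A B / A `<=` B >-> A <= B}.
Proof.
move=> A B AB; apply: ereal_inf_le_tmp => _ [G [oG BG] <-].
by exists G => //; split => //; exact: subset_trans BG.
Qed.

Lemma outer_content_approx M (e : R) : (0 < e)%R ->
  exists G, [/\ open G, M `<=` G & inner_content G <= outer_content M + e%:E].
Proof.
move=> e0.
have [_ [G [oG MG] <-] Ge] := lb_ereal_inf_adherent e0 (outer_content_fin_num M).
by exists G; split => //; exact/ltW.
Qed.

Lemma outer_content_sigma_subadditive : sigma_subadditive outer_content.
Proof.
move=> A; apply/lee_addgt0Pr => e e0.
apply: (le_trans _ (epsilon_trick xpredT _ (ltW e0))); last first.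
  by move=> n; exact: outer_content_ge0.
have /choice[G GP] n : exists G, [/\ open G, A n `<=` G & inner_content G <=
    outer_content (A n) + (e / (2 ^ n.+1)%:R)%:E].
  by apply: outer_content_approx; rewrite divr_gt0// ltr0n expn_gt0.
apply: (@le_trans _ _ (inner_content (\bigcup_n G n))).
  rewrite -outer_content_open; last by apply: bigcup_open => n _; have [] := GP n.
  by apply: outer_content_le; apply: subset_bigcup => n _; have [] := GP n.
apply: le_trans (inner_content_bigcup _) _ => [n|]; first by have [] := GP n.
apply: lee_nneseries => [n _ _|n _]; first exact: inner_content_ge0.
by have [] := GP n.
Qed.

HB.instance Definition _ := isOuterMeasure.Build R T outer_content
  outer_content_set0 outer_content_ge0 outer_content_le
  outer_content_sigma_subadditive.

Lemma inner_content_approx G (e : R) : (0 < e)%R ->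
  exists C, [/\ compact C, C `<=` G & inner_content G <= lam C + e%:E].
Proof.
move=> e0.
have fG : inner_content G \is a fin_num.
  by rewrite ge0_fin_numE ?inner_content_ge0// (le_lt_trans (inner_content_le1 _))// ltry.
have [_ [C [cC CG] <-] Ge] := ub_ereal_sup_adherent e0 fG.
exists C; split => //; rewrite -leeBlDr//; exact/ltW.
Qed.

(* Approximate [X] by an open [G] from outside, [G \ F] by a compact [C1] from
   inside, then [G \ C1], which contains [X `&` F], by a compact [C0]: [C0] and [C1]
   are disjoint. *)
Lemma caratheodory_content_closed (F : set T) : closed F ->
  outer_content.-caratheodory F.
Proof.
move=> cF; apply: le_caratheodory_measurable => X.
apply/lee_addgt0Pr => e e0.
have e30 : (0 < e / 3)%R by rewrite divr_gt0.
have [G [oG XG Ge]] := outer_content_approx X e30.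
have [C1 [cC1 C1G C1e]] := inner_content_approx (~` F `&` G) e30.
have [C0 [cC0 C0G C0e]] := inner_content_approx (~` C1 `&` G) e30.
have h1 : outer_content (X `&` ~` F) <= lam C1 + (e / 3)%:E.
  apply: le_trans C1e; rewrite -outer_content_open; last first.
    by apply: openI => //; exact: closed_openC.
  by apply: outer_content_le => x [Xx nFx]; split => //; exact: XG.
have h0 : outer_content (X `&` F) <= lam C0 + (e / 3)%:E.
  apply: le_trans C0e; rewrite -outer_content_open; last first.
    by apply: openI => //; exact/closed_openC/(compact_closed hT).
  apply: outer_content_le => x [Xx Fx]; split; last exact: XG.
  by move=> /C1G[].
apply: le_trans (leeD h0 h1) _.
rewrite addeACA -EFinD.
have h2 : lam C0 + lam C1 <= outer_content X + (e / 3)%:E.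
  apply: le_trans Ge; apply: le_trans (lamUd cC0 cC1 _) _.
    by rewrite -subset0 => x [/C0G[nC1x _]].
  apply: le_inner_content; first exact: compactU.
  by move=> x [/C0G[]|/C1G[]].
apply: le_trans (leeD h2 (lexx _)) _.
by rewrite -addeA -EFinD leeD2l// lee_fin; lra.
Qed.

Lemma caratheodory_content_sigma :
  <<s @open T >> `<=` outer_content.-caratheodory.
Proof.
apply: smallest_sub => [|U oU].
  split; first exact: caratheodory_measurable_set0.
    by move=> A; rewrite setTD; exact: caratheodory_measurable_setC.
  by move=> F mF; exact: caratheodory_measurable_bigcup.
rewrite -(setCK U); apply: caratheodory_measurable_setC.
exact/caratheodory_content_closed/open_closedC.
Qed.

Lemma compact_content_measure d (M : measurableType d) (f : T -> M) :
  (forall B, measurable B -> <<s @open T >> (f @^-1` B)) ->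
  exists m : {measure set M -> \bar R},
    forall B, m B = outer_content (f @^-1` B).
Proof.
move=> mf; apply: (caratheodory_pushforward (mu := outer_content)) => B mB.
exact: (caratheodory_content_sigma (mf _ mB)).
Qed.

End compact_content.

Lemma ultra_cvg01 (R : realType) (U : set_system nat) (UU : UltraFilter U)
  (u : nat -> R) : (forall n, 0 <= u n <= 1)%R -> cvg (u @ U).
Proof.
move=> u01.
have : (u @ U) `[0%R, 1%R]%classic.
  by apply: nearW => n /=; rewrite in_itv/= u01.
move=> /(@segment_compact R 0%R 1%R (u @ U) _)[p [_ clp]].
apply/cvg_ex; exists p => V pV.
have [//|nV] := in_ultra_setVsetC (u @^-1` V) UU.
have [x [/= Vx nVx]] := clp (~` V) V nV pV.
by [].
Qed.

(* Completes the [ptopologicalType] structure of products. *)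
HB.instance Definition _ (S A : ptopologicalType) :=
  Pointed.on (S * A)%type.

Section probability_of_measure.
Context d (T : measurableType d) (R : realType).
Variables (m : {measure set T -> \bar R}) (m1 : m setT = 1).

Definition mprobability of m setT = 1 : set T -> \bar R := m.

HB.instance Definition _ := Measure.on (mprobability m1).

HB.instance Definition _ := Measure_isProbability.Build _ _ _ (mprobability m1) m1.

End probability_of_measure.

Section limit_measure.
Context (R : realType) (S A : ptopologicalType).
Local Notation SA := (borel S * borel A)%type.
Hypothesis (hT : hausdorff_space (S * A)%type) (regT : regular_space (S * A)%type).
Hypothesis openM : forall V : set (S * A), open V -> measurable (V : set SA).
Variables (U : set_system nat) (UU : UltraFilter U).
Variable mu : nat -> {measure set SA -> \bar R}.
Hypothesis mu1 : forall n, mu n setT = 1.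

Lemma closedM (F : set (S * A)) : closed F -> measurable (F : set SA).
Proof.
move=> cF; rewrite -(setCK F); apply: measurableC.
by apply: openM; exact: closed_openC.
Qed.

Lemma compactM (F : set (S * A)) : compact F -> measurable (F : set SA).
Proof. by move=> cF; apply: closedM; exact: (compact_closed hT). Qed.

Let mu_le1 n (B : set SA) : measurable B -> mu n B <= 1.
Proof. by move=> mB; rewrite -(mu1 n) le_measure// inE. Qed.

Let mu_fin n (B : set SA) : measurable B -> mu n B \is a fin_num.
Proof.
move=> mB; rewrite ge0_fin_numE//; apply: le_lt_trans (mu_le1 _ mB) _.
by rewrite ltry.
Qed.

(** An ultrafilter makes the values on all measurable sets converge at once; extracting a
    subsequence would achieve this only for countably many sets. *)
Definition limit_content (B : set SA) : R := lim (fine (mu n B) @[n --> U]).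

Lemma cvg_limit_content B : measurable B ->
  fine (mu n B) @[n --> U] --> limit_content B.
Proof.
move=> mB; apply: ultra_cvg01 => n; rewrite fine_ge0//=.
by rewrite -lee_fin fineK ?mu_fin// mu_le1.
Qed.

Let PU : ProperFilter U := ultra_proper.

Lemma limit_content0 : limit_content set0 = 0%R.
Proof.
apply/cvg_lim => //.
under eq_fun do rewrite measure0 /=.
exact: cvg_cst.
Qed.

Lemma le_limit_content B C : measurable B -> measurable C -> B `<=` C ->
  (limit_content B <= limit_content C)%R.
Proof.
move=> mB mC BC; apply: ler_cvg_to (cvg_limit_content mB) (cvg_limit_content mC) _.
by apply: nearW => n; rewrite fine_le ?mu_fin// le_measure// inE.
Qed.

Lemma limit_contentU B C : measurable B -> measurable C ->
  (limit_content (B `|` C) <= limit_content B + limit_content C)%R.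
Proof.
move=> mB mC; have cD : (fine (mu n B) + fine (mu n C))%R @[n --> U] -->
    (limit_content B + limit_content C)%R.
  exact: (cvgD (cvg_limit_content mB) (cvg_limit_content mC)).
apply: (ler_cvg_to (cvg_limit_content (measurableU _ _ mB mC)) cD).
apply: nearW => n; rewrite -fineD ?mu_fin// fine_le ?fin_numD ?mu_fin//.
  exact: measurableU.
exact: measureU2.
Qed.

Lemma limit_contentUd B C : measurable B -> measurable C -> B `&` C = set0 ->
  limit_content (B `|` C) = (limit_content B + limit_content C)%R.
Proof.
move=> mB mC BC0; apply/cvg_lim => //.
under eq_fun do rewrite measureU// fineD ?mu_fin//.
exact: (cvgD (cvg_limit_content mB) (cvg_limit_content mC)).
Qed.

Lemma limit_contentT : limit_content setT = 1%R.
Proof.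
apply/cvg_lim => //.
under eq_fun do rewrite mu1 /=.
exact: cvg_cst.
Qed.

Hypothesis tight : forall e : R, (0 < e)%R ->
  exists2 C : set (S * A), compact C & \forall n \near U, (1 - e)%:E <= mu n C.

(** On an open set the regularized content is a supremum over compact subsets, so it can only be
    smaller than the limit; this gives the inequality. Tightness prevents a loss on the whole space,
    which gives mass 1. *)
Lemma limit_measure_exists : exists P : probability SA R,
  forall G : set (S * A), open G -> P G <= (limit_content G)%:E.
Proof.
pose lam (C : set (S * A)) := (limit_content C)%:E.
have lam0 : lam set0 = 0 by rewrite /lam limit_content0.
have lam_le C D : compact C -> compact D -> C `<=` D -> lam C <= lam D.
  by move=> cC cD CD; rewrite lee_fin le_limit_content//; exact: compactM.
have lamU C D : compact C -> compact D -> lam (C `|` D) <= lam C + lam D.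
  by move=> cC cD; rewrite -EFinD lee_fin limit_contentU//; exact: compactM.
have lamUd C D : compact C -> compact D -> C `&` D = set0 ->
    lam C + lam D <= lam (C `|` D).
  by move=> cC cD CD0; rewrite /lam limit_contentUd//; exact: compactM.
have lam1 C : compact C -> lam C <= 1.
  move=> cC; rewrite lee_fin -limit_contentT le_limit_content//.
  exact: compactM.
(* The projections are continuous, hence the product sigma-algebra is contained in the Borel sets of
   the product. *)
have sig (B : set SA) : measurable B -> <<s @open (S * A)%type >> (id @^-1` B).
  move=> mB; rewrite preimage_id.
  have mid : measurable_fun [set: borel (S * A)%type]
      (fun x : borel (S * A)%type => (x.1, x.2) : SA).
    apply/measurable_fun_pairP; split => /=.
      apply: measurable_fun_borel => V oV; apply: sub_sigma_algebra.
      have /continuousP : continuous (@fst S A) by move=> ?; exact: cvg_fst.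
      exact.
    apply: measurable_fun_borel => V oV; apply: sub_sigma_algebra.
    have /continuousP : continuous (@snd S A) by move=> ?; exact: cvg_snd.
      exact.
  have := mid measurableT _ mB; rewrite setTI.
  by rewrite (_ : _ @^-1` B = B)//; apply/seteqP; split => -[].
have [m mE] := @compact_content_measure R (S * A)%type hT regT _ lam0
  lam_le lamU lamUd lam1 _ _ _ sig.
have m1 : m setT = 1.
  rewrite mE preimage_id outer_content_open//; last exact: openT.
  apply/eqP; rewrite eq_le inner_content_le1//=.
  apply/lee_addgt0Pr => e e0; have [C cC Ce] := tight e0.
  rewrite -leeBlDr// -EFinB.
  apply: le_trans (le_inner_content lam cC (@subsetT _ C)).
  rewrite lee_fin; apply: cvgr_to_ge (cvg_limit_content (compactM cC)) _.
  by apply: filterS Ce => n; rewrite -lee_fin fineK// mu_fin//; exact: compactM.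
exists (mprobability m1) => G oG; rewrite [leLHS]mE preimage_id outer_content_open//.
apply: ge_ereal_sup => _ [C [cC CG] <-]; rewrite lee_fin le_limit_content//.
  exact: compactM.
exact: openM.
Qed.

End limit_measure.

(** * Integrals of lower semicontinuous costs in the limit *)

Section staircase.
Context (R : realType).
Implicit Types (g e : R) (N : nat).

(* Approximates [g] from below by a combination of indicators of the open sets
   [j * e < g], for which weak convergence gives a one-sided estimate. *)
Definition staircase g e N : R :=
  (\sum_(j < N) e * (j.+1%:R * e < g)%R%:R)%R.

Lemma staircase_ge0 g e N : (0 <= e)%R -> (0 <= staircase g e N)%R.
Proof. by move=> e0; apply: sumr_ge0 => i _; rewrite mulr_ge0. Qed.

Lemma staircase_le g e N : (0 <= e)%R -> (0 <= g)%R -> (staircase g e N <= g)%R.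
Proof.
move=> e0 g0.
suff : (staircase g e N <= g /\ staircase g e N <= N%:R * e)%R by case.
elim: N => [|N [ih1 ih2]]; first by rewrite /staircase big_ord0 mul0r.
rewrite /staircase big_ord_recr/= -/(staircase g e N).
have Ne : (N.+1%:R * e = N%:R * e + e)%R by rewrite -natr1 mulrDl mul1r.
case: ltP => h /=; rewrite ?mulr1 ?mulr0 ?addr0; split => //; lra.
Qed.

Lemma staircase_ge g e N : (0 <= e)%R -> (0 <= g)%R ->
  (Num.min g (N.+1%:R * e) <= staircase g e N + e)%R.
Proof.
move=> e0 g0; elim: N => [|N ih].
  by rewrite /staircase big_ord0 add0r ge_min mul1r lexx orbT.
rewrite /staircase big_ord_recr/= -/(staircase g e N).
have Ne : (N.+2%:R * e = N.+1%:R * e + e)%R by rewrite -natr1 mulrDl mul1r.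
case: ltP => h /=; rewrite ?mulr1 ?mulr0 ?addr0.
  move: ih; rewrite (min_idPr (ltW h)) => ih.
  by rewrite ge_min; apply/orP; right; lra.
by move: ih; rewrite (min_idPl h) => ih; rewrite ge_min ih.
Qed.

(** With [(n+1)^2] steps of size [1/(n+1)] the mesh tends to 0 while the top level, [n+1], tends to
    infinity. *)
Lemma staircase_cvg g : (0 <= g)%R ->
  staircase g n.+1%:R^-1 (n.+1 * n.+1) @[n --> \oo] --> g.
Proof.
move=> g0; apply: (@squeeze_cvgr _ _ _ _ (fun n => g - n.+1%:R^-1)%R (cst g)).
- near=> n; rewrite staircase_le ?invr_ge0// andbT lerBlDr.
  apply: le_trans (staircase_ge _ _ g0); last by rewrite invr_ge0.
  rewrite le_min lexx/=.
  apply: (@le_trans _ _ n%:R); first by near: n; exact: nbhs_infty_ger.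
  rewrite -[leRHS]mulrC ler_pdivlMl ?ltr0n// -natrM ler_nat.
  by rewrite ltnW// ltnS leq_mul2l leqnSn orbT.
- rewrite -[X in _ --> X]subr0; apply: cvgB; first exact: cvg_cst.
  exact: cvg_harmonic.
- exact: cvg_cst.
Unshelve. all: by end_near. Qed.

End staircase.

Lemma limn_einf_le_cst (R : realType) (u : (\bar R)^nat) c :
  (forall n, u n <= c) -> limn_einf u <= c.
Proof.
move=> uc; rewrite limn_einf_lim; apply: lime_le; first exact: is_cvg_einfs.
apply: nearW => n; apply: le_trans (uc n).
by apply: ereal_inf_lbound; exists n => /=.
Qed.

Lemma near_lt_limn_einf (R : realType) (u : (\bar R)^nat) c :
  c < limn_einf u -> \forall n \near \oo, c <= u n.
Proof.
rewrite limn_einf_lim (cvg_lim _ (@cvg_einfs_sup _ u))//.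
move=> /ereal_sup_gt[_ [n _ <-] cn]; exists n => // m /= nm.
apply: le_trans (ltW cn) _; apply: ereal_inf_lbound.
by exists m.
Qed.

Lemma measureI_negligibleC d (T : measurableType d) (R : realType)
    (nu : {measure set T -> \bar R}) (K V : set T) :
  measurable K -> nu (~` K) = 0 -> measurable V -> nu (V `&` K) = nu V.
Proof.
move=> mK nuK mV; rewrite -[in RHS](setUIDK V K) measureU//.
- rewrite [X in _ + X](_ : _ = 0) ?adde0//; apply/eqP.
  rewrite eq_le measure_ge0 andbT -nuK; apply: le_measure; rewrite ?inE.
  + exact: measurableD.
  + exact: measurableC.
  + by move=> x [].
- exact: measurableI.
- exact: measurableD.
- by rewrite setDE setICA -setIA setICr !setI0.
Qed.

Section portmanteau.
Context (R : realType) (S A : ptopologicalType).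
Local Notation SA := (borel S * borel A)%type.
Hypothesis openM : forall V : set (S * A), open V -> measurable (V : set SA).
Variables (U : set_system nat) (UU : UltraFilter U).
Variable mu : nat -> {measure set SA -> \bar R}.
Hypothesis mu1 : forall n, mu n setT = 1.
Variable P : probability SA R.
Hypothesis P_open : forall G : set (S * A), open G ->
  P G <= (limit_content U mu G)%:E.
Variable K : set (S * A).
Hypothesis closedK : closed K.
Hypothesis muK : forall n, mu n (~` K) = 0.

Let mK : measurable (K : set SA).
Proof. exact: closedM. Qed.

Let PU : ProperFilter U := ultra_proper.

Let mufin n (B : set SA) : measurable B -> mu n B \is a fin_num.
Proof.
move=> mB; rewrite ge0_fin_numE//; apply: (@le_lt_trans _ _ (mu n setT)).
  by rewrite le_measure// inE.
by rewrite mu1 ltry.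
Qed.

Lemma limit_measure_setC : P (~` K) = 0.
Proof.
apply/eqP; rewrite eq_le measure_ge0 andbT.
apply: le_trans (P_open (closed_openC closedK)) _; rewrite lee_fin.
rewrite (_ : limit_content _ _ _ = 0%R)//; apply/cvg_lim => //.
under eq_fun do rewrite muK /=.
exact: cvg_cst.
Qed.

Variable g : S * A -> R.
Hypothesis g0 : forall x, K x -> (0 <= g x)%R.
Hypothesis closed_g : forall c : R, (0 <= c)%R ->
  closed (K `&` [set x | (g x <= c)%R]).

(** On [K] this is the set where [g] exceeds [(j+1) * e]. Including the complement of [K] makes it
    open and changes no integral, since the measures concerned do not charge that complement. *)
Let V e (j : nat) : set (S * A) := ~` (K `&` [set x | (g x <= j.+1%:R * e)%R]).

Let openV e j : (0 <= e)%R -> open (V e j).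
Proof. by move=> e0; apply: closed_openC; apply: closed_g; rewrite mulr_ge0. Qed.

Let mV e j : (0 <= e)%R -> measurable (V e j : set SA).
Proof. by move=> e0; apply: openM; exact: openV. Qed.

Lemma measurable_lsc : measurable_fun (K : set SA) (EFin \o g).
Proof.
apply/measurable_EFinP.
apply: (measurability _ (RGenOInfty.measurableE R)) => // _ [_ [y ->] <-].
have [y0|y0] := leP 0%R y; last first.
  rewrite (_ : _ `&` _ = K)//; apply/seteqP; split => x /=; first by case.
  by move=> Kx; split => //=; rewrite in_itv/= andbT (lt_le_trans y0)// g0.
rewrite (_ : _ `&` _ = K `\` (K `&` [set x | (g x <= y)%R])).
  apply: measurableD => //.
  by apply: closedM => //; exact: closed_g.
apply/seteqP; split => x /=.
  by rewrite in_itv/= andbT => -[Kx yx]; split => // -[_]; rewrite leNgt yx.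
by rewrite in_itv/= andbT => -[Kx nx]; split => //; rewrite ltNge; apply/negP => gy; exact: nx.
Qed.

Let staircaseE e N x : K x ->
  (staircase (g x) e N = \sum_(j < N) e * \1_(V e j) x)%R.
Proof.
move=> Kx; apply: eq_bigr => j _; congr (_ * _)%R.
rewrite indicE; congr (_%:R); congr nat_of_bool.
apply/idP/idP => [h|]; first by rewrite inE => -[_] /=; rewrite leNgt h.
by rewrite inE => h; rewrite ltNge; apply/negP => gj; exact: h.
Qed.

Let measurable_staircase e N : (0 <= e)%R ->
  measurable_fun (K : set SA) (fun x => (staircase (g x) e N)%:E).
Proof.
move=> e0; apply: (@eq_measurable_fun _ _ _ _ _
    (fun x : SA => (\sum_(j < N) e * \1_(V e j) x)%:E)).
  by move=> x; rewrite inE => Kx; rewrite staircaseE.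
apply/measurable_EFinP; apply: measurable_sum => j.
by apply: measurable_funM => //; apply: measurable_indic; exact: mV.
Qed.

Let integral_staircase (nu : {measure set SA -> \bar R}) e N : (0 <= e)%R ->
  nu (~` K) = 0 ->
  \int[nu]_(x in K) (staircase (g x) e N)%:E = \sum_(j < N) e%:E * nu (V e j).
Proof.
move=> e0 nuK.
transitivity (\int[nu]_(x in K) \sum_(j < N) (e%:E * (\1_(V e j) x)%:E)).
  apply: eq_integral => x; rewrite inE => Kx; rewrite staircaseE// -sumEFin.
  by apply: eq_bigr => j _; rewrite EFinM.
rewrite ge0_integral_sum//; last 2 first.
- move=> j; apply: measurable_funeM; apply/measurable_EFinP.
  by apply: measurable_indic; exact: mV.
- by move=> j x _; rewrite mule_ge0// lee_fin.
apply: eq_bigr => j _; rewrite ge0_integralZl_EFin//; first last.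
- by apply/measurable_EFinP; apply: measurable_indic; exact: mV.
congr (_ * _); rewrite integral_indic ?measureI_negligibleC//; exact: mV.
Qed.

(** The integral of a staircase is a finite combination of the masses of the open sets [V e j]:
    [P_open] bounds each term, and the limit along [U] commutes with the finite sum. *)
Lemma portmanteau (c : R) :
  (\forall n \near U, \int[mu n]_(x in K) (g x)%:E <= c%:E) ->
  \int[P]_(x in K) (g x)%:E <= c%:E.
Proof.
move=> gc.
have step e N : (0 <= e)%R ->
    \int[P]_(x in K) (staircase (g x) e N)%:E <= c%:E.
  move=> e0; rewrite integral_staircase//; last exact: limit_measure_setC.
  apply: (@le_trans _ _ (\sum_(j < N) e * limit_content U mu (V e j))%:E%R).
    rewrite -sumEFin; apply: lee_sum => j _; rewrite EFinM lee_pmul//.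
    by apply: P_open; exact: openV.
  rewrite lee_fin.
  have cv : (\sum_(j < N) e * fine (mu n (V e j)))%R @[n --> U] -->
      (\sum_(j < N) e * limit_content U mu (V e j))%R.
    apply: cvg_big => [|j _]; first exact: add_continuous.
    apply: cvgMr.
    by apply: cvg_limit_content => //; exact: mV.
  apply: (cvgr_to_le cv); apply: filterS gc => n gcn.
  rewrite -lee_fin; apply: le_trans gcn; rewrite -sumEFin.
  rewrite (_ : \sum_(j < N) _ = \int[mu n]_(x in K) (staircase (g x) e N)%:E).
    apply: ge0_le_integral => //.
    - by move=> x Kx; rewrite lee_fin staircase_ge0.
    - exact: measurable_staircase.
    - exact: measurable_lsc.
    - by move=> x Kx; rewrite lee_fin staircase_le// g0.
  rewrite integral_staircase//; apply: eq_bigr => j _.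
  by rewrite EFinM fineK// mufin//; exact: mV.
(* Refining the mesh does not make the staircases increase with [n], so Fatou's lemma is used rather
   than monotone convergence. *)
pose s n x := (staircase (g x) n.+1%:R^-1 (n.+1 * n.+1))%:E.
apply: (@le_trans _ _ (\int[P]_(x in K) limn_einf (s^~ x))).
  rewrite le_eqVlt; apply/orP; left; apply/eqP; apply: eq_integral => x.
  rewrite inE => Kx; apply/esym.
  have : s n x @[n --> \oo] --> (g x)%:E.
    by apply: cvg_EFin; [exact: nearW|exact: staircase_cvg (g0 Kx)].
  by move/cvg_limn_einf_sup => [->].
apply: le_trans (fatou P mK _ _) _.
- by move=> n; apply: measurable_staircase; rewrite invr_ge0.
- by move=> n x Kx; rewrite lee_fin staircase_ge0// invr_ge0.
apply: limn_einf_le_cst => n.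
by apply: step; rewrite invr_ge0.
Qed.

End portmanteau.

(** * Integration against kernels, closed sublevel sets and invariance *)

Section integral_mbind.
Context d d' (X : measurableType d) (Y : measurableType d') (R : realType).
Variables (m : {measure set X -> \bar R}) (k : R.-ker X ~> Y).
Import HBNNSimple.

Let integral_mbind_nnsfun (f : {nnsfun Y >-> R}) :
  \int[mbind m k]_y (f y)%:E = \int[m]_x \int[k x]_y (f y)%:E.
Proof.
rewrite integralT_nnsfun sintegralE.
under [RHS]eq_integral do rewrite integralT_nnsfun sintegralE.
have k0 (x : X) (n : R) : 0 <= n%:E * k x (f @^-1` [set n]).
  by apply: (mulemu_ge0 (fun n => f @^-1` [set n])) => r0; rewrite preimage_nnfun0.
have mk (n : R) : measurable_fun [set: X] (fun x => k x (f @^-1` [set n])).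
  exact: measurable_kernel.
rewrite ge0_integral_fsum//; last by move=> n; exact: measurable_funeM.
apply: eq_fsbigr => n _; have [n0|n0] := leP 0%R n.
  by rewrite ge0_integralZl_EFin.
rewrite preimage_nnfun0// measure0 mule0; apply/esym/integral0_eq => x _.
by rewrite measure0 mule0.
Qed.

Lemma ge0_integral_mbind (f : Y -> \bar R) :
  (forall y, 0 <= f y) -> measurable_fun [set: Y] f ->
  \int[mbind m k]_y f y = \int[m]_x \int[k x]_y f y.
Proof.
move=> f0 mf; pose f_ := nnsfun_approx measurableT mf.
have fE (mu : {measure set Y -> \bar R}) :
    \int[mu]_y f y = limn (fun n => \int[mu]_y (f_ n y)%:E).
  rewrite -monotone_convergence//; last 3 first.
    by move=> n; exact/measurable_EFinP.
    by move=> n z _; rewrite lee_fin.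
    by move=> z _ a b ab; rewrite lee_fin; exact/lefP/nd_nnsfun_approx.
  by apply: eq_integral => z _; apply/esym/cvg_lim => //; exact: cvg_nnsfun_approx.
rewrite fE; under [RHS]eq_integral do rewrite fE.
rewrite monotone_convergence//; last 3 first.
- move=> n; apply: measurable_fun_integral_kernel => //.
  + exact: measurable_kernel.
  + by move=> z; rewrite lee_fin.
  + exact/measurable_EFinP.
- by move=> n x _; apply: integral_ge0 => z _; rewrite lee_fin.
- move=> x _ a b ab; apply: ge0_le_integral => //.
  + by move=> z _; rewrite lee_fin.
  + exact/measurable_EFinP.
  + exact/measurable_EFinP.
  + by move=> z _; rewrite lee_fin; exact/lefP/nd_nnsfun_approx.
by congr (limn _); apply/funext => n; exact: integral_mbind_nnsfun.
Qed.

End integral_mbind.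

Lemma closed_sublevel (R : realType) (T : topologicalType) (K : set T)
    (g : T -> R) (c : R) : closed K ->
  (forall x, K x -> (c < g x)%R ->
    \forall x' \near within K (nbhs x), (c < g x')%R) ->
  closed (K `&` [set x | (g x <= c)%R]).
Proof.
move=> cK gc; rewrite -[X in closed X]setCK; apply: open_closedC.
rewrite openE => x /=; rewrite not_andP => -[nKx|/negP].
  have := closed_openC cK; rewrite openE => /(_ _ nKx).
  by apply: filterS => y nKy [].
rewrite -ltNge => cx; have [Kx|nKx] := pselect (K x); last first.
  have := closed_openC cK; rewrite openE => /(_ _ nKx).
  by apply: filterS => y nKy [].
have := gc _ Kx cx; rewrite near_withinE; apply: filterS => y h [/= Ky].
by rewrite leNgt h.
Qed.

Lemma closed_sublevel_continuous (R : realType) (T : topologicalType)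
    (K : set T) (g : T -> R) (c : R) : closed K ->
  {within K, continuous g} -> closed (K `&` [set x | (g x <= c)%R]).
Proof.
move=> cK /subspace_continuousP cg; apply: closed_sublevel => // x Kx cx.
exact: (cvgr_gt _ (cg x Kx)).
Qed.

Lemma ge0_integral_negligible_setC d (T : measurableType d) (R : realType)
    (m : {measure set T -> \bar R}) (K : set T) (f : T -> \bar R) :
  measurable K -> m (~` K) = 0 -> measurable_fun setT f ->
  (forall x, 0 <= f x) -> \int[m]_(x in K) f x = \int[m]_x f x.
Proof.
move=> mK m0 mf f0; rewrite [RHS](@ge0_negligible_integral _ _ _ _ _ (~` K))//.
  by rewrite setTD setCK.
exact: measurableC.
Qed.

Lemma measurable_integral_kernel_real d d' (X : measurableType d)
    (Y : measurableType d') (R : realType) (k : R.-ker X ~> Y) (h : Y -> R) :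
  measurable_fun setT h -> (forall y, 0 <= h y)%R ->
  measurable_fun setT (fun x => \int[k x]_y (h y)%:E).
Proof.
move=> mh h0; apply: measurable_fun_integral_kernel.
- exact: measurable_kernel.
- by move=> y; rewrite lee_fin.
- exact/measurable_EFinP.
Qed.

Lemma integral_probability01 d (Y : measurableType d) (R : realType)
    (m : {measure set Y -> \bar R}) (h : Y -> R) : m setT = 1 ->
  measurable_fun setT h -> (forall y, 0 <= h y <= 1)%R ->
  0 <= \int[m]_y (h y)%:E <= 1.
Proof.
move=> m1 mh h01; apply/andP; split.
  by apply: integral_ge0 => y _; rewrite lee_fin; have /andP[] := h01 y.
rewrite -m1 -[leRHS]mul1e -integral_cst//; apply: ge0_le_integral => //.
- by move=> y _; rewrite lee_fin; have /andP[] := h01 y.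
- exact/measurable_EFinP.
- by move=> y _; rewrite lee_fin; have /andP[] := h01 y.
Qed.

(* Invariance of [m] is tested through the function [h x.1 + 1 - Q h x], whose
   [m]-integral is [1] exactly when [h] has the same mean before and after a
   transition; adding [1] keeps it nonnegative, so that it can be passed to a limit
   as a cost. *)
Section stationarity_defect.
Context d d' (S : measurableType d) (A : measurableType d') (R : realType).
Variables (K : set (S * A)) (Q : R.-pker (S * A)%type ~> S).
Variable m : {measure set (S * A) -> \bar R}.
Hypothesis (mK : measurable K) (m1 : m setT = 1) (mC : m (~` K) = 0).
Variable h : S -> R.
Hypothesis (mh : measurable_fun setT h) (h01 : forall s, (0 <= h s <= 1)%R).

Let q (x : S * A) : R := (\int[Q x]_xi h xi)%R.

Let Q1 x : Q x setT = 1. Proof. exact: prob_kernel. Qed.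

Let qE x : (q x)%:E = \int[Q x]_xi (h xi)%:E.
Proof.
have /andP[q0 q1] := integral_probability01 (Q1 x) mh h01.
by rewrite /q /Rintegral fineK// ge0_fin_numE// (le_lt_trans q1)// ltry.
Qed.

Let q01 x : (0 <= q x <= 1)%R.
Proof. by rewrite -2!lee_fin qE; exact: integral_probability01 (Q1 x) mh h01. Qed.

Let mq : measurable_fun setT (EFin \o q).
Proof.
apply: (eq_measurable_fun (fun x => \int[Q x]_xi (h xi)%:E)) => [x _|].
  by rewrite /= qE.
by apply: measurable_integral_kernel_real => // s; have /andP[] := h01 s.
Qed.

Lemma integral_kernel01 : 0 <= \int[m]_x \int[Q x]_xi (h xi)%:E <= 1.
Proof.
under eq_integral do rewrite -qE.
exact: integral_probability01 ((measurable_EFinP _ _).1 mq) q01.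
Qed.

(** Stated additively, so that no difference of extended reals has to be formed. *)
Lemma integral_defect :
  \int[m]_(x in K) (h x.1 + 1 - \int[Q x]_xi h xi)%R%:E +
    \int[m]_x \int[Q x]_xi (h xi)%:E = \int[m]_x (h x.1)%:E + 1.
Proof.
have h0 s : (0 <= h s)%R by have /andP[] := h01 s.
pose g (x : S * A) : R := (h x.1 + 1 - q x)%R.
have g0 x : (0 <= g x)%R by rewrite /g; have := q01 x; have := h0 x.1; lra.
have mhfst : measurable_fun setT (fun x : S * A => (h x.1)%:E).
  by apply/measurable_EFinP; exact: (measurableT_comp mh measurable_fst).
have mg : measurable_fun setT (EFin \o g).
  apply/measurable_EFinP; apply: measurable_funB; last exact/measurable_EFinP.
  by apply: measurable_funD => //; exact: (measurableT_comp mh measurable_fst).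
rewrite -/(g _) ge0_integral_negligible_setC//.
under [X in _ + X = _]eq_integral do rewrite -qE.
rewrite -[X in _ = _ + X]m1 -[X in _ = _ + X]mul1e -[X in _ = _ + X]integral_cst//.
rewrite -[RHS]ge0_integralD//; last by move=> x _; rewrite lee_fin.
rewrite -ge0_integralD//.
- by apply: eq_integral => x _; rewrite /= -!EFinD /g subrK.
- by move=> x _; rewrite lee_fin; exact: g0.
- by move=> x _; rewrite lee_fin; have /andP[] := q01 x.
Qed.

End stationarity_defect.

(** * Tightness from the cost and invariance of the limit *)

Lemma closed_cost_sublevel (R : realType) (T : topologicalType) (K : set T)
    (r : T -> R) : hausdorff_space T ->
  (forall eps, (0 <= eps)%R -> compact [set x | K x /\ (- eps <= r x)%R]) ->
  forall c, (0 <= c)%R -> closed (K `&` [set x | (- r x <= c)%R]).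
Proof.
move=> hT r_compact c c0; apply: (compact_closed hT); rewrite (_ : _ `&` _ =
  [set x | K x /\ (- c <= r x)%R]); first exact: r_compact.
by apply/seteqP; split => x /= [Kx h]; split => //; lra.
Qed.

Section compactness.
Context (R : realType) (S A : ptopologicalType).
Hypothesis (borelS : borel_space R S) (borelA : borel_space R A).
Local Notation SA := (borel S * borel A)%type.
Variable K : set (S * A).
Hypothesis closedK : closed K.
Variables (Q : R.-pker SA ~> borel S) (r : S * A -> R).
Hypothesis r_le0 : forall x, K x -> (r x <= 0)%R.
Hypothesis r_compact : forall eps : R, (0 <= eps)%R ->
  compact [set x : S * A | K x /\ (- eps <= r x)%R].
Hypothesis Q_weakly_continuous : forall h : S -> R, continuous h ->
  (exists M : R, forall s, (`|h s| <= M)%R) ->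
  {within K, continuous (fun x : S * A => (\int[Q x]_xi h xi)%R)}.

Let hT : hausdorff_space (S * A)%type.
Proof.
exact: (hausdorff_prod (borel_space_hausdorff borelS)
  (borel_space_hausdorff borelA)).
Qed.

Let regT : regular_space (S * A)%type.
Proof.
exact: (regular_prod (borel_space_regular borelS)
  (borel_space_regular borelA)).
Qed.

Let openM := open_prod_measurable borelS borelA.

Let mK : measurable (K : set SA).
Proof. exact: (closedM openM). Qed.

Let closed_r := closed_cost_sublevel hT r_compact.

Lemma measurable_cost : measurable_fun (K : set SA) (fun x => (- r x)%:E).
Proof.
by apply: (measurable_lsc openM closedK) => // x Kx; rewrite oppr_ge0 r_le0.
Qed.

Variable mu : nat -> {measure set SA -> \bar R}.
Hypothesis mu1 : forall n, mu n setT = 1.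
Hypothesis muK : forall n, mu n (~` K) = 0.
Variable C : R.
Hypothesis mu_r : \forall n \near \oo, \int[mu n]_(x in K) (- r x)%:E <= C%:E.

(** Markov's inequality: on the part of [K] outside this compact set the cost [- r] exceeds [N]. *)
Let mu_compact N : (0 < N)%R -> \forall n \near \oo,
  (1 - C / N)%:E <= mu n [set x | K x /\ (- N <= r x)%R].
Proof.
move=> N0; apply: filterS mu_r => n rC.
set KN := (X in mu n X).
have mKN : measurable (KN : set SA) by apply: (compactM hT openM); apply: r_compact; exact: ltW.
have : N%:E * mu n (K `\` KN) <= C%:E.
  apply: le_trans rC; rewrite -(setIid (K `\` KN)).
  rewrite -integral_cst//; last by apply: measurableI; exact: measurableD.
  rewrite setIid; apply: (@le_trans _ _ (\int[mu n]_(x in K `\` KN) (- r x)%:E)).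
    apply: ge0_le_integral => //.
    - exact: measurableD.
    - by move=> x _; rewrite lee_fin ltW.
    - by apply: measurable_funS measurable_cost => // x [].
    - move=> x [Kx nKN]; rewrite lee_fin leNgt; apply/negP => rN.
      by apply: nKN; split => //; lra.
  apply: ge0_subset_integral => //; first exact: measurableD.
  - exact: measurable_cost.
  - by move=> x Kx; rewrite lee_fin oppr_ge0 r_le0.
rewrite muleC -lee_pdivlMr// => muKN.
have : 1 <= mu n KN + (C / N)%:E.
  rewrite -(mu1 n) -(measureI_negligibleC mK (muK n) measurableT) setTI.
  have KKN : K = KN `|` K `\` KN by rewrite setDUK// => x [].
  rewrite [X in mu n X <= _]KKN measureU//; last 2 first.
  - exact: measurableD.
  - by rewrite setDIK.
  by rewrite leeD2l// EFinM.
by rewrite -leeBlDr// EFinB.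
Qed.

Hypothesis stationary : forall h : S -> R, continuous h ->
  (forall s, 0 <= h s <= 1)%R -> forall e : R, (0 < e)%R ->
  \forall n \near \oo, \int[mu n]_(x in K) (h x.1 + 1 - \int[Q x]_xi h xi)%R%:E
    <= (1 + e)%:E.

(** A single limit has to serve the reward and all thresholds [eta] simultaneously, hence the last
    clause is quantified over every cost [g]. *)
Lemma occupation_limit : exists P : probability SA R, [/\ P (~` K) = 0,
  forall B : set (borel S), measurable B ->
    P (K `&` [set x | B x.1]) = \int[P]_(x in K) Q x B
  & forall g : S * A -> R, (forall x, K x -> 0 <= g x)%R ->
    (forall c, (0 <= c)%R -> closed (K `&` [set x | (g x <= c)%R])) ->
    forall c : R, (\forall n \near \oo, \int[mu n]_(x in K) (g x)%:E <= c%:E) ->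
    \int[P]_(x in K) (g x)%:E <= c%:E].
Proof.
have [U [UU ooU]] := @ultraFilterLemma nat \oo _.
have tight (e : R) : (0 < e)%R ->
    exists2 D : set (S * A), compact D & \forall n \near U, (1 - e)%:E <= mu n D.
  (* [N >= C / e] makes the escaping mass at most [e]; the maximum with 1 keeps [N] positive
     whatever the sign of [C]. *)
  move=> e0; pose N := (Num.max C 1 / e)%R.
  have N0 : (0 < N)%R by rewrite divr_gt0// lt_max ltr01 orbT.
  exists [set x | K x /\ (- N <= r x)%R]; first by apply: r_compact; exact: ltW.
  apply: ooU; apply: filterS (mu_compact N0) => n; apply: le_trans.
  rewrite lee_fin lerD2l lerN2 /N ler_pdivrMr ?divr_gt0 ?lt_max ?ltr01 ?orbT//.
  by rewrite mulrC divfK ?gt_eqF// le_max lexx.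
have [P P_open] := limit_measure_exists hT regT openM UU mu1 tight.
have PK : P (~` K) = 0 by exact: (limit_measure_setC UU P_open closedK muK).
have port (g : S * A -> R) : (forall x, K x -> 0 <= g x)%R ->
    (forall c, (0 <= c)%R -> closed (K `&` [set x | (g x <= c)%R])) ->
    forall c : R, (\forall n \near \oo, \int[mu n]_(x in K) (g x)%:E <= c%:E) ->
    \int[P]_(x in K) (g x)%:E <= c%:E.
  move=> g0 cg c gc; apply: (portmanteau openM UU mu1 P_open closedK muK g0 cg).
  exact: ooU.
exists P; split => // B mB.
have mfst : measurable_fun [set: SA] (fst : SA -> borel S) by exact: measurable_fst.
pose pushfst : {measure set (borel S) -> \bar R} :=
  pushforward P (fst : SA -> borel S).
pose m1 : {measure set (borel S) -> \bar R} := pushfst mfst.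
pose m2 : {measure set (borel S) -> \bar R} := mbind P Q.
have m11 : m1 setT = 1.
  by rewrite [LHS](_ : _ = P (fst @^-1` setT))// preimage_setT probability_setT.
have m21 : m2 setT = 1.
  rewrite [LHS](_ : _ = \int[P]_x Q x setT)//.
  under eq_integral do rewrite prob_kernel.
  rewrite integral_cst// mul1e; exact: probability_setT.
have m1E (h : S -> R) : continuous h -> (forall s, 0 <= h s <= 1)%R ->
    \int[m1]_s (h s)%:E = \int[P]_x (h x.1)%:E.
  move=> ch h01; rewrite (ge0_integral_pushforward mfst)//.
  - by apply/measurable_EFinP; exact: continuous_borel.
  - by move=> s _; rewrite lee_fin; have /andP[] := h01 s.
have m2E (h : S -> R) : continuous h -> (forall s, 0 <= h s <= 1)%R ->
    \int[m2]_s (h s)%:E = \int[P]_x \int[Q x]_s (h s)%:E.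
  move=> ch h01; rewrite ge0_integral_mbind//.
  - by move=> s; rewrite lee_fin; have /andP[] := h01 s.
  - by apply/measurable_EFinP; exact: continuous_borel.
have m12 (h : S -> R) : continuous h -> (forall s, 0 <= h s <= 1)%R ->
    \int[m1]_s (h s)%:E <= \int[m2]_s (h s)%:E.
  move=> ch h01; have mh := continuous_borel ch.
  have h0 s : (0 <= h s)%R by have /andP[] := h01 s.
  have Q1 x : Q x setT = 1 by exact: prob_kernel.
  (* This cost is nonnegative because the kernel mean of [h] is at most 1, and continuous on [K] by
     weak continuity, so the bounds [1 + e] pass to the limit. The value 1 is exactly the threshold
     at which the mean of [h] under [m1] does not exceed its mean under [m2]. *)
  have g1 : \int[P]_(x in K) (h x.1 + 1 - \int[Q x]_xi h xi)%R%:E <= 1.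
    apply/lee_addgt0Pr => e e0; rewrite -EFinD; apply: port => //.
    - move=> x _; have /andP[_ q1] := integral_probability01 (Q1 x) mh h01.
      rewrite subr_ge0 (@le_trans _ _ 1%R)//; last by rewrite lerDr.
      by rewrite -lee_fin /Rintegral fineK// ge0_fin_numE ?(le_lt_trans q1) ?ltry//;
        apply: integral_ge0 => s _; rewrite lee_fin.
    - move=> c c0; apply: closed_sublevel_continuous => //.
      apply/subspace_continuousP => x Kx.
      apply: cvgB.
        apply: cvgD; last exact: cvg_cst.
        apply: cvg_within_filter; apply: (cvg_comp _ _ (@cvg_fst _ _ _ _ _)).
        exact: ch.
      have : {within K, continuous (fun x : S * A => (\int[Q x]_xi h xi)%R)}.
        apply: Q_weakly_continuous => //; exists 1%R => s.
        by rewrite ger0_norm//; have /andP[] := h01 s.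
      by move/subspace_continuousP; exact.
    - exact: stationary.
  rewrite m1E// m2E//.
  rewrite -(@leeD2rE _ 1)// -(integral_defect Q mK (probability_setT P) PK mh h01).
  by rewrite addeC leeD2l.
(* Both measures have mass 1, so the inequality for [1 - h] is the reverse inequality for [h]. *)
have m12' (h : S -> R) : continuous h -> (forall s, 0 <= h s <= 1)%R ->
    \int[m1]_s (h s)%:E = \int[m2]_s (h s)%:E.
  move=> ch h01; apply/eqP; rewrite eq_le m12//=.
  have mh := continuous_borel ch.
  have /m12 : continuous (fun s => 1 - h s)%R.
    by move=> s; apply: cvgB; [exact: cvg_cst|exact: ch].
  have h01' s : (0 <= 1 - h s <= 1)%R by have := h01 s; lra.
  move=> /(_ h01').
  have cE (m : {measure set (borel S) -> \bar R}) : m setT = 1 ->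
      \int[m]_s (1 - h s)%:E = 1 - \int[m]_s (h s)%:E.
    move=> mT; have /andP[i0 i1] := integral_probability01 mT mh h01.
    have fi : \int[m]_s (h s)%:E \is a fin_num.
      by rewrite ge0_fin_numE// (le_lt_trans i1)// ltry.
    rewrite -[X in _ = X - _](_ : \int[m]_s (1 - h s)%:E + \int[m]_s (h s)%:E = 1).
      by rewrite addeK.
    rewrite -ge0_integralD//.
    - under eq_integral do rewrite -EFinD subrK.
      by rewrite integral_cst// mul1e mT.
    - by move=> s _; rewrite lee_fin; have /andP[] := h01' s.
    - by apply/measurable_EFinP; exact: measurable_funB.
    - by move=> s _; rewrite lee_fin; have /andP[] := h01 s.
    - exact/measurable_EFinP.
  by rewrite !cE// leeD2lE// leeN2.
have BE := borel_probability_eq borelS m11 m21 m12' mB.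
rewrite setIC (measureI_negligibleC mK PK); last first.
  by have := mfst measurableT _ mB; rewrite setTI.
rewrite ge0_integral_negligible_setC//; last exact: measurable_kernel.
Qed.

End compactness.

(** * Occupation measures *)

Section process.
Context (R : realType) (S A : ptopologicalType).
Local Notation SA := (borel S * borel A)%type.
Local Notation H t := (t.-tuple SA * borel S)%type.
Variable feas : S -> set A.
Local Notation K := (graph feas).
Variable Q : R.-pker SA ~> borel S.
Variable pi : forall t, R.-pker H t ~> borel A.
Variable nu : {measure set (borel S) -> \bar R}.

Lemma integral_kdirac d d' (X : measurableType d) (Y : measurableType d')
    (f : X -> Y) (mf : measurable_fun setT f) (x : X) (F : Y -> \bar R) :
  measurable_fun setT F -> \int[@kdirac _ _ X Y R f mf x]_y F y = F (f x).
Proof. by move=> mF; rewrite integral_dirac// diracT mul1e. Qed.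

Lemma tnth_histS_lt t (x : H t * borel A * borel S) (i : 'I_t.+1) (it : (i < t)%N) :
  tnth (histS x).1 i = tnth x.1.1.1 (Ordinal it).
Proof. by rewrite !(tnth_nth (x.1.1.2, x.1.2)) /= nth_rcons size_tuple it. Qed.

Lemma tnth_histS_eq t (x : H t * borel A * borel S) (i : 'I_t.+1) :
  i = t :> nat -> tnth (histS x).1 i = (x.1.1.2, x.1.2).
Proof.
by move=> it; rewrite (tnth_nth (x.1.1.2, x.1.2)) /= nth_rcons size_tuple it ltnn eqxx.
Qed.

Lemma integral_hist_law0 (F : H 0 -> \bar R) : (forall h, 0 <= F h) ->
  measurable_fun setT F -> \int[hist_law Q pi nu 0]_h F h = \int[nu]_s F (hist0 A s).
Proof.
move=> F0 mF; rewrite ge0_integral_mbind//.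
by apply: eq_integral => s _; rewrite integral_kdirac.
Qed.

Lemma integral_hist_lawS t (F : H t.+1 -> \bar R) : (forall h, 0 <= F h) ->
  measurable_fun setT F -> \int[hist_law Q pi nu t.+1]_h F h =
  \int[hist_law Q pi nu t]_h \int[pi t h]_a \int[Q (h.2, a)]_s F (histS (h, a, s)).
Proof.
move=> F0 mF; rewrite ge0_integral_mbind//.
apply: eq_integral => h _; rewrite integral_kcomp//.
apply: eq_integral => a _; rewrite integral_kcomp//.
by apply: eq_integral => s _; rewrite integral_kdirac.
Qed.

Lemma measurable_pi_integral t (f : H t * borel A -> \bar R) :
  (forall x, 0 <= f x) -> measurable_fun setT f ->
  measurable_fun setT (fun h => \int[pi t h]_a f (h, a)).
Proof. by move=> f0 mf; exact: measurable_fun_integral_finite_kernel. Qed.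

Lemma measurable_Q_integral (f : borel S -> \bar R) :
  (forall x, 0 <= f x) -> measurable_fun setT f ->
  measurable_fun setT (fun x => \int[Q x]_s f s).
Proof.
move=> f0 mf; apply: measurable_fun_integral_kernel => //.
exact: measurable_kernel.
Qed.

Lemma integral_prob_cst d d' (X : measurableType d) (Y : measurableType d')
  (k : R.-pker X ~> Y) x (c : \bar R) : \int[k x]_y c = c.
Proof. by rewrite integral_cst// prob_kernel mule1. Qed.

Definition pair_law t : {measure set SA -> \bar R} :=
  mbind (hist_law Q pi nu t) (pi t \; kdirac (@measurable_last_pair S A t)).

Lemma integral_pair_law t (f : SA -> \bar R) : (forall x, 0 <= f x) ->
  measurable_fun setT f ->
  \int[pair_law t]_x f x = \int[hist_law Q pi nu t]_h \int[pi t h]_a f (h.2, a).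
Proof.
move=> f0 mf; rewrite ge0_integral_mbind//.
apply: eq_integral => h _; rewrite integral_kcomp//.
by apply: eq_integral => a _; rewrite integral_kdirac.
Qed.

Lemma integral_pair_law_fst t (g : borel S -> \bar R) : (forall x, 0 <= g x) ->
  measurable_fun setT g ->
  \int[pair_law t]_x g x.1 = \int[hist_law Q pi nu t]_h g h.2.
Proof.
move=> g0 mg; rewrite integral_pair_law//; last first.
  exact: (measurableT_comp mg measurable_fst).
by apply: eq_integral => h _; rewrite /= integral_prob_cst.
Qed.

Lemma integral_pair_law_kernel t (g : borel S -> \bar R) : (forall x, 0 <= g x) ->
  measurable_fun setT g ->
  \int[pair_law t]_x \int[Q x]_s g s = \int[hist_law Q pi nu t.+1]_h g h.2.
Proof.
move=> g0 mg; rewrite integral_pair_law//; last 2 first.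
- by move=> x; exact: integral_ge0.
- exact: measurable_Q_integral.
rewrite integral_hist_lawS//.
exact: (measurableT_comp mg measurable_snd).
Qed.

Lemma hist_law_setT t : nu setT = 1 -> hist_law Q pi nu t setT = 1.
Proof.
move=> nu1; elim: t => [|t ih].
  rewrite -[LHS]mul1e -integral_cst// integral_hist_law0//.
  by rewrite integral_cst// mul1e.
rewrite -[LHS]mul1e -integral_cst// integral_hist_lawS//.
under eq_integral.
  move=> h _; under eq_integral do rewrite integral_prob_cst.
  rewrite integral_prob_cst; over.
by rewrite integral_cst// mul1e.
Qed.

Lemma pair_law_setT t : nu setT = 1 -> pair_law t setT = 1.
Proof.
move=> nu1; rewrite -[LHS]mul1e -integral_cst// integral_pair_law//.
under eq_integral do rewrite integral_prob_cst.
by rewrite integral_cst// mul1e hist_law_setT.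
Qed.

(** Induction on the horizon: if [t] is not the last index, the newly drawn pair does not affect the
    integrand and its kernels integrate to 1; if it is, the pair just appended has the law
    [pair_law T]. *)
Lemma integral_tnth_hist_law T (t : 'I_T) (f : SA -> \bar R) :
  (forall x, 0 <= f x) -> measurable_fun setT f ->
  \int[hist_law Q pi nu T]_h f (tnth h.1 t) = \int[pair_law t]_x f x.
Proof.
move=> f0 mf; elim: T => [|T ih] in t *; first by case: t.
rewrite integral_hist_lawS//; last first.
  apply: (measurableT_comp mf).
  exact: (measurableT_comp (measurable_tnth t) measurable_fst).
have [tT|Tt] := ltnP t T.
  rewrite -(ih (Ordinal tT)); apply: eq_integral => h _.
  transitivity (\int[pi T h]_a \int[Q (h.2, a)]_s f (tnth h.1 (Ordinal tT))).
    apply: eq_integral => a _; apply: eq_integral => s _.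
    by rewrite (tnth_histS_lt _ tT).
  under eq_integral do rewrite integral_prob_cst.
  by rewrite integral_prob_cst.
have tT : t = T :> nat by apply/eqP; rewrite eqn_leq Tt -ltnS ltn_ord.
rewrite tT integral_pair_law//; apply: eq_integral => h _.
apply: eq_integral => a _.
transitivity (\int[Q (h.2, a)]_s f (h.2, a)).
  by apply: eq_integral => s _; rewrite (tnth_histS_eq _ tT).
by rewrite integral_prob_cst.
Qed.

Hypothesis measurable_feas : forall s, measurable (feas s : set (borel A)).
Hypothesis mK : measurable (K : set SA).
Hypothesis policy_pi : policy feas pi.

Lemma measurable_histories t : measurable (@histories S A feas t : set (H t)).
Proof.
rewrite (_ : @histories S A feas t = \bigcap_(i in [set: 'I_t])
    ((fun h : H t => tnth h.1 i) @^-1` K)).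
  apply: fin_bigcap_measurable => [|i _]; first exact: finite_finset.
  rewrite -[X in measurable X]setTI.
  exact: (measurableT_comp (measurable_tnth i) measurable_fst).
by apply/seteqP; split => h hK i; [move=> _|]; exact: hK.
Qed.

Lemma policy_setC t (h : H t) : histories feas h -> pi t h (~` feas h.2) = 0.
Proof.
move=> hh.
have pT : pi t h setT = 1 by exact: prob_kernel.
have pf : pi t h (feas h.2) = 1 by exact: policy_pi.
have : pi t h (feas h.2 `|` ~` feas h.2) = pi t h (feas h.2) + pi t h (~` feas h.2).
  by rewrite measureU ?setICr//; exact: measurableC.
rewrite setUv pT pf; move: (pi t h (~` feas h.2)) => [x| |]//.
by rewrite -EFinD => -[x0]; congr EFin; lra.
Qed.

(** [policy] constrains [pi t h] only for feasible histories [h], so concentration on feasible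
    actions has to be propagated in time: a feasible history becomes infeasible only through an
    action outside [feas h.2], which has probability 0. *)
Lemma hist_law_setC t : hist_law Q pi nu t (~` @histories S A feas t) = 0.
Proof.
elim: t => [|t ih].
  rewrite (_ : ~` _ = set0) ?measure0//.
  by rewrite -subset0 => h; apply => -[].
have mC := measurableC (@measurable_histories t.+1).
rewrite -[X in _ _ X](setIT) -integral_indic// integral_hist_lawS//; last first.
  by apply/measurable_EFinP; exact: measurable_indic.
have mF : measurable_fun setT (fun x : H t.+1 => (\1_(~` @histories S A feas t.+1) x : R)%:E).
  by apply/measurable_EFinP; exact: measurable_indic.
pose I (x : H t * borel A) := \int[Q (x.1.2, x.2)]_s
  (\1_(~` @histories S A feas t.+1) (histS (x, s)) : R)%:E.
have I0 x : 0 <= I x by apply: integral_ge0 => s _; rewrite lee_fin.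
have mI : measurable_fun setT I.
  apply: (measurable_fun_integral_finite_kernel (fun x => (\1_(~`
    @histories S A feas t.+1) (histS x))%:E) (kprecomp Q (@measurable_last_pair S A t))).
    by move=> x; rewrite lee_fin.
  exact: (measurableT_comp mF (@measurable_histS S A t)).
set G := (X in \int[_]_h X h).
have G0 h : 0 <= G h.
  by apply: integral_ge0 => a _; apply: integral_ge0 => s _; rewrite lee_fin.
have mG : measurable_fun setT G.
  by apply: (measurable_pi_integral (f := I)) => // x; exact: I0.
rewrite -(ge0_integral_negligible_setC (@measurable_histories t) ih mG G0).
apply: integral0_eq => h hh; rewrite /G.
rewrite -(ge0_integral_negligible_setC (K := (feas h.2 : set (borel A))) _ (policy_setC hh))//; last 2 first.
- apply: (measurableT_comp mI (_ : measurable_fun setT (fun a => (h, a)))).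
  apply/measurable_fun_pairP; split; first exact: measurable_cst.
  exact: measurable_id.
- by move=> a; apply: integral_ge0 => s _; rewrite lee_fin.
apply: integral0_eq => a fa; apply: integral0_eq => s _.
rewrite indicE memNset//= => nh; apply: nh => i.
have [it|ti] := ltnP i t; first by rewrite (tnth_histS_lt _ it); exact: hh.
by rewrite tnth_histS_eq//; apply/eqP; rewrite eqn_leq ti -ltnS ltn_ord.
Qed.

Lemma pair_law_setC t : pair_law t (~` K) = 0.
Proof.
have mKC : measurable (~` K : set SA) by exact: measurableC.
rewrite -[X in _ _ X](setIT) -integral_indic// integral_pair_law//; last first.
  by apply/measurable_EFinP; exact: measurable_indic.
rewrite -(ge0_integral_negligible_setC (@measurable_histories t) (hist_law_setC t)).
- apply: integral0_eq => h hh.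
  rewrite (_ : (fun a => _) = (fun a => (\1_(~` feas h.2) a)%:E)); last first.
    by apply/funext => a; congr EFin; rewrite !indicE; congr (_ %:R); congr nat_of_bool; apply/idP/idP; rewrite !inE.
  rewrite integral_indic ?setIT//; last exact: measurableC.
  exact: policy_setC.
- pose J (x : H t * borel A) := (\1_(~` K : set SA) (last_pair x) : R)%:E.
  have J0 x : 0 <= J x by rewrite lee_fin.
  have mJ : measurable_fun setT J.
    apply/measurable_EFinP; apply: (measurableT_comp (measurable_indic mKC)).
    exact: measurable_last_pair.
  exact: (measurable_pi_integral J0 mJ).
- by move=> h; apply: integral_ge0 => a _; rewrite lee_fin.
Qed.

Lemma expected_totalE (f : S * A -> R) T :
  measurable_fun (K : set SA) f -> (forall x, K x -> f x <= 0)%R ->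
  expected_total feas Q f pi nu T =
  - \sum_(t < T) \int[pair_law t]_(x in K) (- f x)%:E.
Proof.
move=> mf f0; rewrite /expected_total.
have mhist := @measurable_histories T.
(* [f] is controlled on [K] only. Cutting [- f] off to 0 elsewhere yields a nonnegative function on
   the whole space, whose integral is additive even when the total is infinite. *)
pose F : SA -> \bar R := (fun x => (- f x)%:E) \_ K.
have F0 x : 0 <= F x.
  by rewrite /F patchE; case: ifPn => // /set_mem Kx; rewrite lee_fin oppr_ge0 f0.
have mF : measurable_fun setT F.
  apply/(measurable_restrictT _ _).1 => //.
  by apply/measurable_EFinP; exact: measurable_funN.
transitivity (\int[hist_law Q pi nu T]_(h in @histories S A feas T)
    - \sum_(t < T) F (tnth h.1 t)).
  apply: eq_integral => h /set_mem hh.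
  rewrite -sumEFin -sumeN//; last first.
    by move=> i j _ _; rewrite /F !patchE !mem_set//.
  by apply: eq_bigr => t _; rewrite /F patchE mem_set ?opprK//= ?opprK.
rewrite integral_ge0N; last by move=> h _; exact: sume_ge0.
congr (- _); rewrite ge0_integral_sum//; last first.
  move=> t; apply: measurable_funTS; apply: (measurableT_comp mF).
  exact: (measurableT_comp (measurable_tnth t) measurable_fst).
apply: eq_bigr => t _.
rewrite ge0_integral_negligible_setC//; last 2 first.
- exact: hist_law_setC.
- apply: (measurableT_comp mF).
  exact: (measurableT_comp (measurable_tnth t) measurable_fst).
by rewrite integral_tnth_hist_law// -integral_mkcond.
Qed.

(** The average is over the first [T + 1] pairs: the divisor never vanishes, and the total mass is 1
    for every [T] when [nu] has mass 1. *)
Definition occupation T : {measure set SA -> \bar R} :=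
  mscale ((T.+1%:R^-1)%:nng : {nonneg R})%R (msum pair_law T.+1).

End process.

Section occupation.
Context (R : realType) (S A : ptopologicalType).
Local Notation SA := (borel S * borel A)%type.
Local Notation H t := (t.-tuple SA * borel S)%type.
Variable feas : S -> set A.
Local Notation K := (graph feas).
Variable Q : R.-pker SA ~> borel S.
Variable pi : forall t, R.-pker H t ~> borel A.
Hypothesis measurable_feas : forall s, measurable (feas s : set (borel A)).
Hypothesis mK : measurable (K : set SA).
Hypothesis policy_pi : policy feas pi.
Variable nu : {measure set (borel S) -> \bar R}.
Hypothesis nu1 : nu setT = 1.
Local Notation occ := (occupation Q pi nu).

Lemma integral_occupation (D : set SA) T (f : SA -> \bar R) : measurable D ->
  (forall x, D x -> 0 <= f x) -> measurable_fun D f ->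
  \int[occ T]_(x in D) f x =
  T.+1%:R^-1%:E * \sum_(t < T.+1) \int[pair_law Q pi nu t]_(x in D) f x.
Proof.
move=> mD f0 mf; rewrite ge0_integral_mscale//; congr (_ * _).
by rewrite ge0_integral_measure_sum.
Qed.

Lemma occupationE T B :
  occ T B = T.+1%:R^-1%:E * \sum_(t < T.+1) pair_law Q pi nu t B.
Proof. by []. Qed.

Lemma occupation_setT T : occ T setT = 1.
Proof.
rewrite occupationE.
rewrite (eq_bigr (fun=> 1%:E)) => [|t _]; last exact: pair_law_setT.
by rewrite sumEFin sumr_const card_ord -EFinM mulVf.
Qed.

Lemma occupation_setC T : occ T (~` K) = 0.
Proof.
rewrite occupationE big1 ?mule0// => t _.
exact: (pair_law_setC _ _ measurable_feas mK policy_pi).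
Qed.

Lemma average_occupation (f : S * A -> R) T :
  measurable_fun (K : set SA) f -> (forall x, K x -> f x <= 0)%R ->
  T.+1%:R^-1%:E * expected_total feas Q f pi nu T.+1 =
  - \int[occ T]_(x in K) (- f x)%:E.
Proof.
move=> mf f0; rewrite (expected_totalE _ _ measurable_feas)//.
rewrite integral_occupation ?muleN//.
  by move=> x Kx; rewrite lee_fin oppr_ge0 f0.
by apply/measurable_EFinP; exact: measurable_funN.
Qed.

(** The defect telescopes. The means of [h] before and after a transition are the averages of
    [e 0, ..., e T] and of [e 1, ..., e (T+1)]; the first exceeds the second by at most
    [e 0 / (T+1)], and [e 0 <= 1]. *)
Lemma occupation_stationary (h : S -> R) T :
  measurable_fun [set: borel S] h -> (forall s, 0 <= h s <= 1)%R ->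
  \int[occ T]_(x in K) (h x.1 + 1 - \int[Q x]_xi h xi)%R%:E
    <= (1 + T.+1%:R^-1)%:E.
Proof.
move=> mh h01.
have h0 s : (0 <= h s)%R by have /andP[] := h01 s.
have mhfst : measurable_fun [set: SA] (fun x : SA => (h x.1)%:E).
  by apply/measurable_EFinP; exact: (measurableT_comp mh measurable_fst).
have e1 := integral_defect Q mK (occupation_setT T) (occupation_setC T) mh h01.
pose e t := \int[hist_law Q pi nu t]_x (h x.2)%:E.
have mhsnd t : measurable_fun [set: H t] (fun x : H t => h x.2).
  exact: (measurableT_comp mh measurable_snd).
have e01 t : 0 <= e t <= 1.
  exact: (integral_probability01 (hist_law_setT _ _ _ nu1) (mhsnd t)
    (fun x => h01 x.2)).
have efin t : e t \is a fin_num.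
  by have /andP[e0 et1] := e01 t; rewrite ge0_fin_numE// (le_lt_trans et1)// ltry.
have hE0 s : 0 <= (EFin \o h) s by rewrite lee_fin.
have mhE : measurable_fun [set: borel S] (EFin \o h) by exact/measurable_EFinP.
have hE : \int[occ T]_x (h x.1)%:E = T.+1%:R^-1%:E * \sum_(t < T.+1) e t.
  rewrite integral_occupation//; last by move=> x _; rewrite lee_fin.
  congr (_ * _); apply: eq_bigr => t _.
  exact: (integral_pair_law_fst _ _ _ _ hE0 mhE).
have qE : \int[occ T]_x \int[Q x]_s (h s)%:E =
    T.+1%:R^-1%:E * \sum_(t < T.+1) e t.+1.
  rewrite integral_occupation//; last 2 first.
  - by move=> x _; apply: integral_ge0 => s _; rewrite lee_fin.
  - exact: measurable_integral_kernel_real.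
  congr (_ * _); apply: eq_bigr => t _.
  exact: (integral_pair_law_kernel _ _ _ _ hE0 mhE).
have qfin : \int[occ T]_x \int[Q x]_s (h s)%:E \is a fin_num.
  have /andP[q0 q1] := integral_kernel01 Q (occupation_setT T) mh h01.
  by rewrite ge0_fin_numE// (le_lt_trans q1)// ltry.
rewrite -(leeD2rE _ _ qfin) e1 hE qE EFinD -addeA addeC leeD2l//.
rewrite -[X in X + _]mule1 -ge0_muleDr//; last first.
  by apply: sume_ge0 => t _; have /andP[] := e01 t.+1.
rewrite lee_pmul2l//.
apply: (@le_trans _ _ (\sum_(t < T.+2) e t)).
  rewrite [leRHS]big_ord_recr/= leeDl//; by have /andP[] := e01 T.+1.
by rewrite big_ord_recl leeD2r//; have /andP[] := e01 0%N.
Qed.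

End occupation.

(** * Stationary policies started from an invariant law *)

Section invariance.
Context (R : realType) (S A : ptopologicalType).
Local Notation SA := (borel S * borel A)%type.
Local Notation H t := (t.-tuple SA * borel S)%type.
Variable Q : R.-pker SA ~> borel S.
Variable phi : R.-pker borel S ~> borel A.
Variable nu : {measure set (borel S) -> \bar R}.
Variable mu : {measure set SA -> \bar R}.
Hypothesis muE : forall f : SA -> \bar R, (forall x, 0 <= f x) ->
  measurable_fun setT f -> \int[mu]_x f x = \int[nu]_s \int[phi s]_a f (s, a).
Hypothesis muQ : forall B : set (borel S), measurable B ->
  \int[mu]_x Q x B = nu B.
Local Notation pi := (policy_of_stationary phi).

(** The induction needs every [g]: testing the state at time [t+1] with [g] is testing the state at
    time [t] with the mean of [g] after one step, and [muE] followed by [muQ] turns the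
    [nu]-integral of that mean back into the one of [g]. *)
Lemma hist_law_invariant t (g : borel S -> \bar R) : (forall s, 0 <= g s) ->
  measurable_fun setT g ->
  \int[hist_law Q pi nu t]_h g h.2 = \int[nu]_s g s.
Proof.
elim: t g => [|t ih] g g0 mg.
  rewrite integral_hist_law0//.
  exact: (measurableT_comp mg measurable_snd).
rewrite -integral_pair_law_kernel// integral_pair_law//; last 2 first.
- by move=> x; exact: integral_ge0.
- exact: measurable_Q_integral.
have mQg := measurable_Q_integral Q g0 mg.
rewrite (ih (fun s => \int[phi s]_a \int[Q (s, a)]_s' g s')).
- rewrite -(muE (f := fun x => \int[Q x]_s g s))//; last first.
    by move=> x; exact: integral_ge0.
  rewrite -ge0_integral_mbind//.
  by apply: eq_measure_integral => B mB _; exact: muQ.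
- by move=> s; apply: integral_ge0 => a _; exact: integral_ge0.
- apply: (measurable_fun_integral_finite_kernel (fun x => \int[Q x]_s g s)) => //.
  by move=> x; exact: integral_ge0.
Qed.

Lemma pair_law_invariant t (f : SA -> \bar R) : (forall x, 0 <= f x) ->
  measurable_fun setT f -> \int[pair_law Q pi nu t]_x f x = \int[mu]_x f x.
Proof.
move=> f0 mf; rewrite integral_pair_law// muE//.
rewrite (hist_law_invariant _ (g := fun s => \int[phi s]_a f (s, a)))//.
  by move=> s; exact: integral_ge0.
exact: measurable_fun_integral_finite_kernel.
Qed.

End invariance.

(** * Disintegration *)

(* Points of a Borel space are coded by the real number whose ternary digits [0]
   and [2] record membership in the sets of a countable base; the absence of the
   digit [1] makes the digits readable from the number. *)
Section ternary.
Context (R : realType).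
Implicit Type c : nat -> bool.
Local Open Scope ring_scope.

Definition bshift c : nat -> bool := fun j => c j.+1.

(** Recursion from the first digit, so that removing this digit corresponds to the map
    [x |-> 3 * x - 2 * c 0] iterated in [residue]. *)
Fixpoint ternary_sum n c : R :=
  if n is m.+1 then (2 * (c 0%N)%:R + ternary_sum m (bshift c)) / 3 else 0.

Definition ternary c : R := limn (ternary_sum ^~ c).

Lemma ternary_sum01 n c : 0 <= ternary_sum n c <= 1.
Proof.
elim: n c => [|n ih] c /=; first by rewrite lexx ler01.
have := ih (bshift c); case: (c 0%N) => /=; lra.
Qed.

Lemma ternary_sum_nondecreasing c : nondecreasing_seq (ternary_sum ^~ c).
Proof.
apply/nondecreasing_seqP => n; elim: n c => [|n ih] c.
  by have /andP[] := ternary_sum01 1 c.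
have E m : ternary_sum m.+1 c =
  (2 * (c 0%N)%:R + ternary_sum m (bshift c)) / 3 by [].
by rewrite !E ler_pM2r ?invr_gt0// lerD2l; exact: ih.
Qed.

Lemma ternary_sum_cvg c : ternary_sum n c @[n --> \oo] --> ternary c.
Proof.
apply: nondecreasing_is_cvgn; first exact: ternary_sum_nondecreasing.
by exists 1 => _ [n _ <-]; have /andP[] := ternary_sum01 n c.
Qed.

Lemma ternary01 c : 0 <= ternary c <= 1.
Proof.
apply/andP; split.
  apply: (cvgr_to_ge (@ternary_sum_cvg c)); apply: nearW => n.
  by have /andP[] := ternary_sum01 n c.
apply: (cvgr_to_le (@ternary_sum_cvg c)); apply: nearW => n.
by have /andP[] := ternary_sum01 n c.
Qed.

Lemma ternaryE c : ternary c = (2 * (c 0%N)%:R + ternary (bshift c)) / 3.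
Proof.
have h1 : ternary_sum n.+1 c @[n --> \oo] --> ternary c.
  have := @ternary_sum_cvg c; rewrite -(cvg_shiftS (ternary_sum ^~ c)); exact.
have h2 : ternary_sum n.+1 c @[n --> \oo] -->
    (2 * (c 0%N)%:R + ternary (bshift c)) / 3.
  apply: cvgM; last exact: cvg_cst.
  by apply: cvgD; [exact: cvg_cst|exact: ternary_sum_cvg].
by apply: cvg_unique h1 h2.
Qed.

Fixpoint residue j (x : R) : R :=
  if j is i.+1 then residue i (3 * x - 2 * (2 <= 3 * x)%R%:R) else x.

Definition digit j (x : R) : bool := 2 <= 3 * residue j x.

(** A first digit 0 leaves [3 * x] in [[0, 1]] and a first digit 2 puts it in [[2, 3]]: the gap
    makes the test [2 <= 3 * x] exact. *)
Lemma digit_ternary c j : digit j (ternary c) = c j.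
Proof.
have d0 c' : (2 <= 3 * ternary c') = c' 0%N.
  have := ternary01 (bshift c'); rewrite (ternaryE c').
  by case: (c' 0%N) => /= ?; [apply/idP; lra|apply/negbTE; rewrite -ltNge; lra].
rewrite /digit; elim: j c => [|j ih] c /=; first exact: d0.
rewrite d0 (_ : _ - _ = ternary (bshift c)); first by rewrite ih.
by rewrite [in LHS]ternaryE; lra.
Qed.

Lemma measurable_residue j : measurable_fun setT (residue j).
Proof.
elim: j => [|j ih] /=; first exact: measurable_id.
pose g (x : R) : R := 3 * x - 2 * (2 <= 3 * x)%R%:R.
suff mg : measurable_fun setT g by exact: (measurableT_comp ih mg).
apply: measurable_funB; first exact: measurable_funM.
apply: measurable_funM => //.
rewrite (_ : (fun x => _) = \1_[set x : R | 2 <= 3 * x]); last first.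
  by apply/funext => x; rewrite indicE; congr (_%:R); congr nat_of_bool; apply/idP/idP; rewrite inE.
apply: measurable_indic.
rewrite -[X in measurable X]setTI.
apply: (measurable_fun_ler _ _ measurableT (Y := [set true])) => //.
Qed.

Lemma measurable_digit j : measurable [set x | digit j x].
Proof.
rewrite -[X in measurable X]setTI.
apply: (measurable_fun_ler _ _ measurableT (Y := [set true])) => //.
by apply: measurable_funM => //; exact: measurable_residue.
Qed.

Lemma measurable_ternary d (T : measurableType d) (B : nat -> set T) :
  (forall j, measurable (B j)) ->
  measurable_fun setT (fun x => ternary (fun j => x \in B j)).
Proof.
move=> mB; apply: (measurable_fun_cvg
  (h := fun n x => ternary_sum n (fun j => x \in B j))) => [n|x _]; last first.
  exact: ternary_sum_cvg.
elim: n B mB => [|n ih] B mB /=; first exact: measurable_cst.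
apply: measurable_funM => //; apply: measurable_funD.
  by apply: measurable_funM => //; exact: measurable_indic.
by apply: (ih (fun j => B j.+1)).
Qed.

End ternary.

Section coding.
Context (R : realType) (T : ptopologicalType).
Hypothesis bT : borel_space R T.

(* The decoding map sends [x] to the limit of the approximations [e (N n x)], and
   to [x0] where they do not converge. *)
Lemma countable_limit_measurable (X : completePseudoMetricType R)
    (hX : hausdorff_space X) (e : nat -> X)
    (eP : forall O : set X, open O -> O !=set0 -> exists k, O (e k))
    (N : nat -> R -> nat)
    (mN : forall n k, measurable [set x | N n x = k]) (x0 : X) :
  exists l : R -> X,
    (forall V, <<s @open X >> V -> measurable (l @^-1` V)) /\
    (forall x y, e (N n x) @[n --> \oo] --> y -> l x = y).
Proof.
have mP (P : nat -> Prop) n : measurable [set x | P (N n x)].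
  rewrite (_ : [set x | _] = \bigcup_(k in P) [set x | N n x = k]).
    by apply: bigcup_measurable => k _; exact: mN.
  by apply/seteqP; split => x /=; [move=> Px; exists (N n x)|move=> [k Pk /= ->]].
have mE (P : nat -> Prop) : measurable [set x | \forall n \near \oo, P (N n x)].
  rewrite (_ : [set x | _] = \bigcup_m \bigcap_(n in [set n | (m <= n)%N]) [set x | P (N n x)]).
    by apply: bigcup_measurable => m _; apply: bigcap_measurable => [|n _];
      [exists m => /=|exact: mP].
  apply/seteqP; split => x /=.
    by move=> [m _ mPx]; exists m => // n /=; exact: mPx.
  by move=> [m _ mPx]; exists m => // n /=; exact: mPx.
pose p x n := e (N n x).
pose G := [set x | cvg (p x n @[n --> \oo])].
(* By completeness convergence is the Cauchy property, and by density the centres of the small balls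
   can be taken among the [e k]; only countable operations remain. *)
have GE : G = \bigcap_m \bigcup_k
    [set x | \forall n \near \oo, ball (e k) (m.+1%:R^-1 : R) (p x n)].
  apply/seteqP; split => x.
    move=> /cvg_cauchy/cauchyP xc m _.
    have m0 : (0 < m.+1%:R^-1 / 2 :> R)%R by rewrite divr_gt0// invr_gt0.
    have [y /= yp] := xc _ m0.
    have [k ek] := eP (ball y (m.+1%:R^-1 / 2 : R))° (@open_interior _ _)
      (ex_intro _ y (nbhsx_ballx _ _ m0)).
    have {}ek := interior_subset ek.
    exists k => //=; apply: filterS yp => n; apply: ball_split.
    exact: ball_sym.
  move=> xb; apply: cauchy_cvg; apply: cauchy_exP => r r0.
  have [m _ mr] := @near_infty_natSinv_lt R (PosNum r0).
  have [k _ kb] := xb m I; exists (e k).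
  apply: filterS kb => n; apply: le_ball; apply: ltW.
  exact: (mr m (leqnn m)).
have mG : measurable G.
  rewrite GE; apply: bigcap_measurable => // m _; apply: bigcup_measurable => k _.
  exact: (mE (fun j => ball (e k) (m.+1%:R^-1 : R) (e j))).
pose l x := if pselect (G x) then lim (p x n @[n --> \oo]) else x0.
exists l; split; last first.
  move=> x y py; rewrite /l; case: pselect => [Gx|nGx].
    exact: (cvg_lim hX py).
  by case: nGx; apply/cvg_ex; exists y.
have lopen (V : set X) : open V -> measurable (G `&` l @^-1` V).
  move=> oV.
  rewrite (_ : _ `&` _ = G `&` \bigcup_(km in [set km : nat * nat |
      ball (e km.1) (km.2.+1%:R^-1 + km.2.+1%:R^-1 : R)%R `<=` V])
      [set x | \forall n \near \oo, ball (e km.1) (km.2.+1%:R^-1 : R) (p x n)]).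
    apply: measurableI => //; rewrite bigcup_mkcond.
    apply: countable_bigcupT_measurable => // -[k m] /=; case: ifPn => // _.
    exact: (mE (fun j => ball (e k) (m.+1%:R^-1 : R) (e j))).
  apply/seteqP; split => x [Gx].
    rewrite /= /l; case: pselect => //= Gx' Vl; split => //.
    have [k [m [kl kV]]] := dense_ball_base eP oV Vl.
    exists (k, m) => //=.
    have : p x n @[n --> \oo] --> lim (p x n @[n --> \oo]) by exact: Gx.
    by apply; exact: kl.
  move=> [[k m] /= kV kb]; split => //=; rewrite /l; case: pselect => //= Gx'.
  have lc : p x n @[n --> \oo] --> lim (p x n @[n --> \oo]) by exact: Gx.
  have m0 : (0 < m.+1%:R^-1 :> R)%R by rewrite invr_gt0.
  have lb := lc _ (nbhsx_ballx _ _ m0).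
  have [n [kn ln]] : exists n, ball (e k) (m.+1%:R^-1 : R) (p x n) /\
      ball (lim (p x n @[n --> \oo])) (m.+1%:R^-1 : R) (p x n).
    by have [n [? ?]] := @filter_ex _ \oo _ _ (filterI kb lb); exists n.
  by apply: kV; apply: ball_triangle kn _; exact: ball_sym.
have lG (V : set X) : measurable (~` G `&` l @^-1` V).
  have [Vx0|nVx0] := pselect (V x0).
    rewrite (_ : _ `&` _ = ~` G); first exact: measurableC.
    apply/seteqP; split => x /=; first by case.
    by move=> nGx; split => //=; rewrite /l; case: pselect.
  rewrite (_ : _ `&` _ = set0)//; rewrite -subset0 => x [nGx] /=.
  by rewrite /l; case: pselect.
have lE (V : set X) : l @^-1` V = (G `&` l @^-1` V) `|` (~` G `&` l @^-1` V).
  by rewrite -setIUl setUv setTI.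
suff : <<s @open X >> `<=` [set V | measurable (l @^-1` V)] by [].
apply: smallest_sub => /=.
  split => /=; first by rewrite preimage_set0.
    by move=> V mV; rewrite setTD preimage_setC; exact: measurableC.
  by move=> F mF; rewrite preimage_bigcup; exact: bigcupT_measurable.
by move=> V oV /=; rewrite lE; apply: measurableU => //; exact: lopen.
Qed.

(** The code of [x] lists the balls around the dense sequence that contain [i x]. Decoding picks at
    each scale [n] the first centre whose ball is listed; these centres converge to [i x]. *)
Lemma borel_space_coding : exists (f : borel T -> R) (h : R -> borel T),
  [/\ measurable_fun setT f, measurable_fun setT h & cancel f h].
Proof.
have [X [i [hX [D cD dD] ii oT rX]]] := bT.
have [e eP] := dense_sequence (i point) cD dD.
pose B j : set (borel T) := if (choice.unpickle j : option (nat * nat)) is Some (k, n) then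
  i @^-1` (ball (e k) (n.+1%:R^-1 : R))° else set0.
have mB j : measurable (B j).
  rewrite /B; case: choice.unpickle => [[k n]|]; last exact: measurable0.
  apply: sub_sigma_algebra; apply/oT.
  by exists (ball (e k) (n.+1%:R^-1 : R))° => //; exact: open_interior.
pose f (x : borel T) : R := ternary R (fun j => x \in B j).
have mf : measurable_fun setT f by exact: measurable_ternary.
pose hit (n : nat) (y : R) (k : nat) : bool := digit (choice.pickle (k, n)) y.
pose N n (y : R) : nat := if pselect (exists k, hit n y k) is left ex then ex_minn ex else 0%N.
have mhit n k : measurable [set y | hit n y k] by exact: measurable_digit.
have mN n k : measurable [set y | N n y = k].
  (* The last set accounts for the default: [N n y] is also 0 when no ball of scale [n] is listed in
     [y]. *)
  have -> : [set y | N n y = k] =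
      ([set y | hit n y k] `&` \bigcap_(j in [set j | (j < k)%N]) ~` [set y | hit n y j])
      `|` (if k == 0%N then \bigcap_j ~` [set y | hit n y j] else set0).
    apply/seteqP; split => y /=.
      rewrite /N; case: pselect => [ex|nex].
        case: ex_minnP => m hm minm <-; left; split => // j /= jm hj.
        by have := minm _ hj; rewrite leqNgt jm.
      by move=> <-; right; rewrite eqxx => j _ /= hj; apply: nex; exists j.
    case=> [[hk kmin]|].
      rewrite /N; case: pselect => [ex|[]]; last by exists k.
      case: ex_minnP => m hm minm; apply/eqP; rewrite eqn_leq minm//=.
      by rewrite leqNgt; apply/negP => mk; exact: (kmin m mk).
    case: eqP => // -> nh; rewrite /N; case: pselect => // -[j hj].
    by have := nh j I hj.
  apply: measurableU.
    apply: measurableI => //; rewrite bigcap_mkcond.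
    by apply: bigcapT_measurable => j; case: ifPn => // _; exact: measurableC.
  case: ifP => // _; apply: bigcapT_measurable => j; exact: measurableC.
have [l [ml lP]] := countable_limit_measurable hX eP mN (i point).
have lf x : l (f x) = i x.
  apply: lP; apply/cvg_ballP => r r0.
  have [m _ mr] := @near_infty_natSinv_lt R (PosNum r0).
  exists m => // n /= mn.
  have hitP k : hit n (f x) k <-> (ball (e k) (n.+1%:R^-1 : R))° (i x).
    rewrite /hit /f digit_ternary /B choice.pickleK; split; first by move/set_mem.
    by move=> ?; apply/mem_set.
  have n0 : (0 < n.+1%:R^-1 :> R)%R by rewrite invr_gt0.
  have hitN : hit n (f x) (N n (f x)).
    rewrite /N; case: pselect => [ex|[]]; first by case: ex_minnP.
    have [k [m' [kx kV]]] := dense_ball_base eP (@open_interior _ (ball (i x) (n.+1%:R^-1 / 2)%R))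
      (nbhs_singleton (nbhs_interior (nbhsx_ballx (i x) _ (divr_gt0 n0 (ltr0Sn R 1))))).
    exists k; apply/hitP; rewrite /interior nbhs_ballP.
    exists (n.+1%:R^-1 / 2)%R => /=; first exact: divr_gt0.
    move=> y; apply: ball_split; apply: ball_sym.
    apply: interior_subset; apply: kV; apply: nbhs_singleton; apply: nbhsx_ballx.
    by rewrite addr_gt0// invr_gt0.
  have /hitP/interior_subset bx := hitN.
  apply: ball_sym; apply: le_ball bx; apply: ltW; exact: (mr n mn).
pose h (y : R) : borel T := xget point [set x | i x = l y].
have hf : cancel f h.
  move=> x; rewrite /h lf; case: xgetP => [y _ /ii//|/(_ x) /= nx].
  by case: nx.
exists f, h; split => //.
apply: measurable_fun_borel => U /oT[V oV UV].
(* The second set collects the [y] for which [l y] is off the range of [i], where [h] takes the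
   default value [point]. Both sets are measurable because [range i] is Borel in [X]. *)
have -> : h @^-1` U = (l @^-1` (V `&` range i)) `|`
    (if pselect (U point) then ~` (l @^-1` range i) else set0).
  apply/seteqP; split => y /=; rewrite /h; case: xgetP.
  - move=> x _ /= ixl; rewrite UV /= ixl => Vl; left; split => //.
    by exists x.
  - move=> none Up; right; case: pselect => //= _ -[x _ ixl].
    exact: (none x).
  - move=> x _ /= ixl [[Vl _]|]; first by rewrite UV /= ixl.
    by case: pselect => //= _; case; exists x.
  - move=> none [[Vl [x _ ixl]]|]; first by have := none x.
    by case: pselect.
apply: measurableU.
  rewrite preimage_setI; apply: measurableI; apply: ml => //.
  exact: sub_sigma_algebra.
by case: pselect => //= Up; apply: measurableC; exact: ml.
Qed.

End coding.

(** * Conditional laws through densities and quantiles *)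

Section subprobability_of_measure.
Context d (T : measurableType d) (R : realType).
Variables (m : {measure set T -> \bar R}) (m1 : m setT <= 1).

Definition msubprobability of m setT <= 1 : set T -> \bar R := m.

HB.instance Definition _ := Measure.on (msubprobability m1).

HB.instance Definition _ :=
  Measure_isSubProbability.Build _ _ _ (msubprobability m1) m1.

End subprobability_of_measure.

Section density.
Context d (T : measurableType d) (R : realType).

Lemma le_integral_null (nu : {measure set T -> \bar R}) (f g : T -> R) :
  measurable_fun setT f -> measurable_fun setT g ->
  (forall x, 0 <= g x)%R -> \int[nu]_x (g x)%:E < +oo ->
  (forall B, measurable B -> \int[nu]_(x in B) (f x)%:E <= \int[nu]_(x in B) (g x)%:E) ->
  nu [set x | (g x < f x)%R] = 0.
Proof.
move=> mf mg g0 goo fg; set N := [set x | _].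
have mN : measurable N.
  rewrite -[X in measurable X]setTI.
  exact: (measurable_fun_ltr mg mf measurableT (Y := [set true])).
have mfN : measurable_fun N (fun x => (f x)%:E) by apply/measurable_EFinP; exact: measurable_funTS.
have mgN : measurable_fun N (fun x => (g x)%:E) by apply/measurable_EFinP; exact: measurable_funTS.
have mfgN : measurable_fun N (fun x => (f x - g x)%:E).
  by apply/measurable_EFinP; apply: measurable_funTS; exact: measurable_funB.
have gN : \int[nu]_(x in N) (g x)%:E \is a fin_num.
  rewrite ge0_fin_numE; last by apply: integral_ge0 => x _; rewrite lee_fin.
  apply: le_lt_trans goo; apply: ge0_subset_integral => //.
  - exact/measurable_EFinP.
  - by move=> x _; rewrite lee_fin.
have e : \int[nu]_(x in N) (f x)%:E =
    \int[nu]_(x in N) (g x)%:E + \int[nu]_(x in N) (f x - g x)%:E.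
  rewrite -ge0_integralD//.
  - by apply: eq_integral => x _; rewrite -EFinD addrC subrK.
  - by move=> x _; rewrite lee_fin.
  - by move=> x xN; rewrite lee_fin subr_ge0 ltW.
have := fg _ mN; rewrite e -[leRHS]adde0 leeD2lE// => fg0.
have {}fg0 : \int[nu]_(x in N) `|(f x - g x)%:E| = 0.
  rewrite (eq_integral (fun x => (f x - g x)%:E)); last first.
    by move=> x /set_mem xN; rewrite gee0_abs// lee_fin subr_ge0 ltW.
  apply/eqP; rewrite eq_le fg0 integral_ge0// => x xN.
  by rewrite lee_fin subr_ge0 ltW.
have [M [mM M0 NM]] := (ae_eq_integral_abs nu mN mfgN).1 fg0.
apply/eqP; rewrite eq_le measure_ge0 andbT -M0 le_measure ?inE// => x Nx.
by apply: NM => /= /(_ Nx) []/eqP; rewrite subr_eq0 gt_eqF.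
Qed.

Lemma density_exists (nu : probability T R) (m : {measure set T -> \bar R}) :
  (forall B, measurable B -> m B <= nu B) ->
  exists F : T -> R, [/\ measurable_fun setT F, forall x, (0 <= F x)%R
    & forall B, measurable B -> m B = \int[nu]_(x in B) (F x)%:E].
Proof.
move=> mnu.
have m1 : m setT <= 1 by rewrite -(probability_setT nu); exact: mnu.
pose m' : subprobability T R := msubprobability m1.
have dom : m' `<< nu.
  apply/null_content_dominatesP => B mB B0; apply/eqP.
  by rewrite eq_le measure_ge0 andbT -B0; exact: mnu.
exists (fine \o Radon_Nikodym_SigmaFinite.f m' nu); split.
- apply: (measurableT_comp (fine_measurable measurableT)).
  exact: measurable_int (Radon_Nikodym_SigmaFinite.f_integrable dom).
- by move=> x; rewrite fine_ge0// Radon_Nikodym_SigmaFinite.f_ge0.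
- move=> B mB.
  rewrite [LHS](Radon_Nikodym_SigmaFinite.f_integral dom mB).
  apply: eq_integral => x _ /=.
  by rewrite fineK// Radon_Nikodym_SigmaFinite.f_fin_num.
Qed.

End density.

Section quantile.
Context (R : realType).

Definition unit_lebesgue : probability (measurableTypeR R) R :=
  uniform_prob (@ltr01 R).

Lemma unit_lebesgue_le (g : R) : (0 <= g <= 1)%R ->
  unit_lebesgue [set u | (u <= g)%R] = g%:E.
Proof.
move=> /andP[g0 g1].
have mg : measurable [set u : R | (u <= g)%R].
  have := @measurable_itv R `]-oo, g]; rewrite set_itvE; exact.
rewrite -[X in _ X = _]setIT -integral_indic// integral_uniform//; last first.
  by apply/measurable_EFinP; exact: measurable_indic.
rewrite subr0 invr1 mul1e integral_indic//.
rewrite [LHS](_ : _ = lebesgue_measure ([set` `[0%R, g]] : set R)); last first.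
  congr (lebesgue_measure _); apply/seteqP; split => u /=; rewrite !in_itv/=.
    by move=> [ug /andP[-> _]].
  by move=> /andP[-> ug]; split => //=; exact: le_trans g1.
rewrite lebesgue_measure_itv/= lte_fin; case: ltP => [|g0']; first by rewrite sube0.
by congr EFin; apply/eqP; rewrite eq_le g0 g0'.
Qed.

End quantile.

(* [F q] is a density with respect to [nu] of the measure
   [B |-> mu (B x {f <= q})], and [G q] its correction on the null set [N] where
   [q |-> F q] fails to be monotone or bounded by [1].  The quantile function [X]
   of these conditional distribution functions turns a uniform random number into
   a random variable with the prescribed conditional law. *)
Section conditional_kernel.
Context d d' (S : measurableType d) (A : measurableType d') (R : realType).
Variables (f : A -> R) (h : R -> A).
Hypothesis (mf : measurable_fun setT f) (mh : measurable_fun setT h).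
Hypothesis fK : cancel f h.
Variables (nu : probability S R) (mu : {measure set (S * A) -> \bar R}).
Hypothesis nuE : forall B, measurable B -> nu B = mu (B `*` setT).
Local Notation lambda := (unit_lebesgue R).

Let mu1 : mu setT = 1.
Proof. by rewrite -setXTT -nuE// probability_setT. Qed.

Let W q : set (S * A) := setT `*` [set a | (f a <= ratr q)%R].

Let mfle (x : R) : measurable [set a | (f a <= x)%R].
Proof.
rewrite -[X in measurable X]setTI.
apply: (measurable_fun_ler mf _ measurableT (Y := [set true])) => //.
Qed.

Let mW q : measurable (W q).
Proof. by apply: measurableX. Qed.

Let cdf_density_exists (q : rat) : exists F : S -> R, [/\ measurable_fun setT F,
  forall x, (0 <= F x)%R
  & forall B, measurable B ->
    mu (B `*` [set a | (f a <= ratr q)%R]) = \int[nu]_(x in B) (F x)%:E].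
Proof.
have mfst : measurable_fun [set: S * A] (fst : S * A -> S) by exact: measurable_fst.
pose m0 : {measure set S -> \bar R} := pushforward (mrestr mu (mW q)) (fst : S * A -> S).
pose m := m0 mfst.
have mE B : m B = mu (B `*` [set a | (f a <= ratr q)%R]).
  congr (mu _); apply/seteqP; split => -[s a] /=.
    by move=> [/= Bs [_ ?]].
  by move=> [].
have [|F [mF F0 FE]] := @density_exists _ _ _ nu m.
  move=> B mB; rewrite mE nuE// le_measure ?inE//.
  - exact: measurableX.
  - exact: measurableX.
  - by move=> -[s a] [].
by exists F; split => // B mB; rewrite -mE FE.
Qed.

Let F q := sval (cid (cdf_density_exists q)).

Let mF q : measurable_fun setT (F q).
Proof. by rewrite /F; case: cid => ? []. Qed.

Let F0 q x : (0 <= F q x)%R.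
Proof. by rewrite /F; case: cid => ? []. Qed.

Let FE q B : measurable B ->
  \int[nu]_(x in B) (F q x)%:E = mu (B `*` [set a | (f a <= ratr q)%R]).
Proof. by rewrite /F; case: cid => ? [? ? /= e] mB; rewrite e. Qed.

Let N1 (pq : rat * rat) : set S :=
  if (pq.1 <= pq.2)%R then [set x | (F pq.2 x < F pq.1 x)%R] else set0.
Let N2 q : set S := [set x | (1 < F q x)%R].
(** One index per pair of rationals, so that [N] is a countable union of null sets. *)
Let N3 (n : nat) : set S :=
  if (choice.unpickle n : option (rat * rat)) is Some pq then N1 pq `|` N2 pq.1 else set0.
Let N : set S := \bigcup_n N3 n.

Let N3sub pq : N1 pq `|` N2 pq.1 `<=` N.
Proof.
have <- : N3 (choice.pickle pq) = N1 pq `|` N2 pq.1 by rewrite /N3 choice.pickleK.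
exact: (@bigcup_sup _ _ (choice.pickle pq) setT N3 I).
Qed.

Let mlt (g1 g2 : S -> R) : measurable_fun setT g1 -> measurable_fun setT g2 ->
  measurable [set x | (g1 x < g2 x)%R].
Proof.
move=> m1 m2; rewrite -[X in measurable X]setTI.
exact: (measurable_fun_ltr m1 m2 measurableT (Y := [set true])).
Qed.

Let mN1 pq : measurable (N1 pq).
Proof. by rewrite /N1; case: ifP => // _; exact: mlt. Qed.

Let mN2 q : measurable (N2 q).
Proof. by apply: mlt => //; exact: measurable_cst. Qed.

Let mN : measurable N.
Proof.
apply: bigcupT_measurable => n; rewrite /N3; case: choice.unpickle => [pq|]//.
exact: measurableU.
Qed.

Let nuN1 pq : nu (N1 pq) = 0.
Proof.
rewrite /N1; case: ifP => [pq12|_]; last exact: measure0.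
apply: le_integral_null => //.
- rewrite FE// (@le_lt_trans _ _ (mu setT))//; last by rewrite mu1 ltry.
  by rewrite le_measure ?inE//; exact: measurableX.
- move=> B mB; rewrite !FE// le_measure ?inE//; [exact: measurableX..|].
  by move=> -[s a] [/= Bs fa]; split => //=; rewrite (le_trans fa)// ler_rat.
Qed.

Let nuN2 q : nu (N2 q) = 0.
Proof.
apply: (@le_integral_null _ _ _ nu (F q) (cst 1%R)) => //.
- rewrite (eq_integral (cst 1))// integral_cst// mul1e.
  by rewrite [ltLHS]probability_setT ltry.
- move=> B mB; rewrite FE// (eq_integral (cst 1))// integral_cst// mul1e.
  rewrite [leRHS]nuE// le_measure ?inE//.
  + exact: measurableX.
  + exact: measurableX.
  + by move=> -[s a] [].
Qed.

Let nuN : nu N = 0.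
Proof.
apply/negligibleP => //; apply: negligible_bigcup => n.
rewrite /N3; case: choice.unpickle => [pq|]; last exact: negligible_set0.
apply: negligibleU; apply/negligibleP.
- exact: mN1.
- exact: nuN1.
- exact: mN2.
- exact: nuN2.
Qed.

Let G q (s : S) : R := if s \in N then 0%R else F q s.

Let mG q : measurable_fun setT (G q).
Proof.
apply: measurable_fun_if => //.
- rewrite (_ : (fun s => s \in N) = (fun s => (0 < \1_N s :> R)%R)).
    by apply: measurable_fun_ltr => //; exact: measurable_indic.
  by apply/funext => s; rewrite indicE; case: (s \in N); rewrite ?ltr01 ?ltxx.
- exact: measurable_funTS.
Qed.

Let G01 q s : (0 <= G q s <= 1)%R.
Proof.
rewrite /G; case: ifPn => [_|]; first by rewrite lexx ler01.
rewrite notin_setE => nN; rewrite F0/= leNgt; apply/negP => F1; apply: nN.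
by apply: (@N3sub (q, q)); right.
Qed.

Let leG p q s : (p <= q)%R -> (G p s <= G q s)%R.
Proof.
move=> pq; rewrite /G; case: ifPn => [//|].
rewrite notin_setE => nN; rewrite leNgt; apply/negP => Fpq; apply: nN.
by apply: (@N3sub (p, q)); left; rewrite /N1 /= pq.
Qed.

Let GE q B : measurable B ->
  \int[nu]_(x in B) (G q x)%:E = mu (B `*` [set a | (f a <= ratr q)%R]).
Proof.
move=> mB; rewrite -FE//; apply: ge0_ae_eq_integral => //.
- by apply/measurable_EFinP; exact: measurable_funTS.
- by apply/measurable_EFinP; exact: measurable_funTS.
- by move=> x _; rewrite lee_fin; have /andP[] := G01 q x.
- by move=> x _; rewrite lee_fin.
exists N; split => // s /= hs; apply: contrapT => nN; apply: hs => Bs.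
by rewrite /G memNset.
Qed.

Let X (su : S * measurableTypeR R) : \bar R :=
  ereal_inf [set (ratr q)%:E | q in [set q : rat | (su.2 <= G q su.1)%R]].

Let E q : set (S * measurableTypeR R) := [set su | (su.2 <= G q su.1)%R].

Let mE q : measurable (E q).
Proof.
rewrite -[X in measurable X]setTI.
apply: (measurable_fun_ler _ _ measurableT (Y := [set true])) => //.
by apply: (measurableT_comp (mG q)); exact: measurable_fst.
Qed.

Let XltE (x : R) : X @^-1` `]-oo, x%:E[%classic = \bigcup_(q in [set q | ratr q < x]%R) E q.
Proof.
apply/seteqP; split => su /=; rewrite in_itv/=.
  move=> /ereal_inf_lt[_ [q /= uG <-]]; rewrite lte_fin => qx.
  by exists q.
move=> [q /= qx uG]; apply: (@le_lt_trans _ _ (ratr q)%:E); last by rewrite lte_fin.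
by apply: ereal_inf_lbound; exists q.
Qed.

Let mX : measurable_fun setT X.
Proof.
apply: (measurability _ (ErealGenInftyO.measurableE R)) => _ [_ [x ->] <-].
rewrite setTI XltE bigcup_mkcond; apply: countable_bigcupT_measurable => // q.
by case: ifPn.
Qed.

(** Replaces the union over all rationals below [x] by an increasing sequence, to which continuity
    of measures from below applies. *)
Let increasing_rationals (x : R) : exists q : nat -> rat,
  [/\ nondecreasing_seq q, forall n, (ratr (q n) < x)%R
    & forall y : R, (y < x)%R -> exists n, (y < ratr (q n))%R].
Proof.
have xn n : (x - n.+1%:R^-1 < x - n.+2%:R^-1)%R.
  by rewrite ltrD2l ltrN2 ltf_pV2 ?posrE// ltr_nat.
have /choice[q qP] n : exists q : rat,
    (x - n.+1%:R^-1 < ratr q < x - n.+2%:R^-1)%R.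
  by have [q] := rat_in_itvoo (xn n); rewrite in_itv/= => ?; exists q.
exists q; split.
- apply/nondecreasing_seqP => n; rewrite -(ler_rat R).
  have /andP[_ /ltW h1] := qP n; have /andP[/ltW h2 _] := qP n.+1.
  exact: le_trans h2.
- move=> n; have /andP[_ h1] := qP n; apply: lt_trans h1 _.
  by rewrite ltrBlDr ltrDl invr_gt0.
- move=> y yx; have xy0 : (0 < x - y)%R by rewrite subr_gt0.
  have [m _ mP] := @near_infty_natSinv_lt R (PosNum xy0).
  exists m; have /andP[h1 _] := qP m; apply: lt_trans h1.
  have hm : (m.+1%:R^-1 < x - y)%R := mP m (leqnn m).
  by rewrite ltrBrDl -ltrBrDr.
Qed.

Let nuE_section q B : measurable B ->
  (nu \x lambda)%E (E q `&` (B `*` setT)) = mu (B `*` [set a | (f a <= ratr q)%R]).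
Proof.
move=> mB; rewrite -GE// [RHS]integral_mkcond /product_measure1.
apply: eq_integral => s _ /=; rewrite patchE.
case: ifPn => sB.
  rewrite -[RHS](unit_lebesgue_le (G01 q s)); congr (lambda _).
  apply/seteqP; split => u; rewrite /xsection/= inE; first by move=> [].
  by move=> uG; split => //=; split => //; exact/set_mem.
rewrite (_ : xsection _ _ = set0) ?measure0// -subset0 => u.
by rewrite /xsection/= inE => -[_ [/= Bs _]]; move/negP: sB; apply; exact/mem_set.
Qed.

Let law_quantile B D : measurable B -> measurable D ->
  (nu \x lambda)%E (X @^-1` D `&` (B `*` setT)) = mu (B `*` (EFin \o f) @^-1` D).
Proof.
move=> mB mD.
have mBT : measurable (B `*` [set: measurableTypeR R]) by exact: measurableX.
have mBA : measurable (B `*` [set: A]) by exact: measurableX.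
have mfsnd : measurable_fun setT (fun sa : S * A => (f sa.2)%:E).
  by apply/measurable_EFinP; exact: (measurableT_comp mf measurable_snd).
pose p1 : {measure set (\bar R) -> \bar R} :=
  pushforward (mrestr (nu \x lambda)%E mBT) X.
pose p2 : {measure set (\bar R) -> \bar R} :=
  pushforward (mrestr mu mBA) (fun sa : S * A => (f sa.2)%:E).
pose m1 := p1 mX; pose m2 := p2 mfsnd.
have m2E D' : m2 D' = mu (B `*` (EFin \o f) @^-1` D').
  congr (mu _); apply/seteqP; split => -[s a] /=; first by move=> [? []].
  by move=> [].
suff : m1 D = m2 D by rewrite m2E.
(* The rays miss [+oo] and cannot exhaust the space; adding the whole space to the class remedies
   this and keeps it stable under intersection. *)
pose GG : set (set (\bar R)) := [set setT] `|` @ErealGenInftyO.G R.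
have gen : @measurable _ (\bar R) = <<s GG >>.
  rewrite [LHS](ErealGenInftyO.measurableE R); apply/seteqP; split.
    apply: smallest_sub; first exact: smallest_sigma_algebra.
    by move=> Y GY; apply: sub_sigma_algebra; right.
  apply: smallest_sub; first exact: smallest_sigma_algebra.
  by move=> Y [->|GY]; [exact: measurableT|exact: sub_sigma_algebra].
have GI : setI_closed GG.
  move=> Y Z [->|[x ->]]; first by rewrite setTI.
  move=> [->|[y ->]]; first by rewrite setIT; right; exists x.
  right; exists (Num.min x y); apply/seteqP; split => z /=; rewrite !in_itv/= EFin_min lt_min.
    by move=> [-> ->].
  by move=> /andP[-> ->].
apply: (measure_unique GG (fun=> setT)) => //.
- by move=> _; left.
- by rewrite bigcup_const.
- move=> Y [->|[x ->]].
    rewrite m2E preimage_setT [LHS](_ : _ = (nu \x lambda)%E (B `*` setT)).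
      by rewrite product_measure1E// [X in _ * X]probability_setT mule1 -nuE.
    by congr (product_measure1 _ _ _); rewrite preimage_setT setTI.
  have [q [ndq qx qcof]] := increasing_rationals x.
  have c1 : mu (B `*` [set a | (f a <= ratr (q n))%R]) @[n --> \oo] --> m1 `]-oo, x%:E[%classic.
    rewrite [X in _ --> X](_ : _ =
        (nu \x lambda)%E (\bigcup_n (E (q n) `&` (B `*` setT)))); last first.
      congr (product_measure1 _ _ _); rewrite XltE setI_bigcupl.
      apply/seteqP; split => su [k kx [Ek Bk]].
        have [n kn] := qcof _ kx; exists n => //; split => //.
        by apply: le_trans Ek _; apply: leG; rewrite -(ler_rat R) ltW.
      by exists (q k) => //; exact: qx.
    rewrite [X in X @ _](_ : _ = (nu \x lambda)%E \o (fun n => E (q n) `&` (B `*` setT))).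
      apply: nondecreasing_cvg_mu.
      - by move=> n; exact: measurableI.
      - by apply: bigcup_measurable => n _; exact: measurableI.
      - apply/nondecreasing_seqP => n; apply/subsetPset => su [En Bn]; split => //.
        by apply: le_trans En _; apply: leG; exact: ndq.
    by apply/funext => n /=; rewrite nuE_section.
  have c2 : mu (B `*` [set a | (f a <= ratr (q n))%R]) @[n --> \oo] --> m2 `]-oo, x%:E[%classic.
    rewrite [X in _ --> X](_ : _ = mu (\bigcup_n (B `*` [set a | (f a <= ratr (q n))%R]))).
      apply: nondecreasing_cvg_mu.
      - by move=> n; exact: measurableX.
      - by apply: bigcup_measurable => n _; exact: measurableX.
      - apply/nondecreasing_seqP => n; apply/subsetPset => -[s a] [/= Bs fa]; split => //=.
        by apply: le_trans fa _; rewrite ler_rat; exact: ndq.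
    rewrite m2E; congr (mu _); apply/seteqP; split => -[s a] /=.
      rewrite in_itv/= lte_fin => -[Bs /qcof[n fn]]; exists n => //; split => //=.
      exact: ltW.
    move=> [n _ [/= Bs fn]]; split => //; rewrite in_itv/= lte_fin.
    exact: le_lt_trans (qx n).
  by apply: cvg_unique c1 c2.
- move=> _; rewrite [ltLHS](_ : _ = nu B).
    by rewrite (le_lt_trans (probability_le1 nu mB))// ltry.
  rewrite nuE//.
  rewrite [LHS](_ : _ = (nu \x lambda)%E (B `*` setT)).
    by rewrite product_measure1E// [X in _ * X]probability_setT mule1 -nuE.
  by congr (product_measure1 _ _ _); rewrite preimage_setT setTI.
Qed.

Let g (su : S * measurableTypeR R) : A := h (fine (X su)).

Let mg : measurable_fun setT g.
Proof.
apply: (measurableT_comp mh); apply: (measurableT_comp _ mX).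
exact: fine_measurable.
Qed.

Let kcond0 : R.-pker S ~> measurableTypeR R :=
  kprobability (measurable_cst (unit_lebesgue R : pprobability _ R)).

(** At [s] this is the law of [g (s, u)] for [u] uniform on the unit interval; as a composition of
    kernels it is measurable in [s]. *)
Definition conditional_kernel : S -> {measure set A -> \bar R} :=
  (kcond0 \; kdirac mg)%E.

HB.instance Definition _ := Kernel.on conditional_kernel.

Let conditional_kernelE s C : measurable C ->
  conditional_kernel s C = lambda [set u | C (g (s, u))].
Proof.
move=> mC.
have mgs : measurable [set u | C (g (s, u))].
  have := measurable_xsection s (mg measurableT mC); rewrite setTI.
  by congr measurable; apply/seteqP; split => u; rewrite /xsection/= inE.
transitivity (\int[lambda]_u (\1_[set u | C (g (s, u))] u)%:E).
  by apply: eq_integral => u _; rewrite /= diracE indicE; congr (_%:R%:E); congr nat_of_bool; apply/idP/idP; rewrite !inE.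
by rewrite integral_indic// setIT.
Qed.

Let conditional_kernel_setT s : conditional_kernel s setT = 1.
Proof. by rewrite conditional_kernelE// -[RHS](probability_setT lambda). Qed.

HB.instance Definition _ :=
  Kernel_isProbability.Build _ _ _ _ _ conditional_kernel conditional_kernel_setT.

Lemma conditional_kernel_exists : exists phi : R.-pker S ~> A,
  forall B C, measurable B -> measurable C ->
    mu (B `*` C) = \int[nu]_(s in B) phi s C.
Proof.
exists conditional_kernel => B C mB mC.
(* Since [h] undoes [f], an event on the action is an event on its code. [fine] gives arbitrary
   values at infinity, but the codes [f a] are finite and [law_quantile] transfers this to [X]. *)
pose D : set (\bar R) := [set x | C (h (fine x))].
have mD : measurable D.
  have mhf := measurableT_comp mh (fine_measurable (measurableT : measurable [set: \bar R])).
  by have := mhf measurableT _ mC; rewrite setTI.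
have -> : mu (B `*` C) = mu (B `*` (EFin \o f) @^-1` D).
  by congr (mu (_ `*` _)); apply/seteqP; split => a; rewrite /D/= fK.
rewrite -(law_quantile mB mD) [RHS]integral_mkcond /product_measure1.
apply: eq_integral => s _ /=; rewrite patchE.
case: ifPn => sB.
  rewrite conditional_kernelE//; congr (lambda _).
  apply/seteqP; split => u; rewrite /xsection/= inE; first by move=> [].
  by move=> Cg; split => //=; split => //; exact/set_mem.
rewrite (_ : xsection _ _ = set0) ?measure0// -subset0 => u.
by rewrite /xsection/= inE => -[_ [/= Bs _]]; move/negP: sB; apply; exact/mem_set.
Qed.

End conditional_kernel.

Section joint_law.
Context d d' (S : measurableType d) (A : measurableType d') (R : realType).
Variables (phi : R.-pker S ~> A) (nu : {measure set S -> \bar R}).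
Variable mu : {measure set (S * A) -> \bar R}.
Hypothesis nu1 : nu setT = 1.
Hypothesis muE : forall B C, measurable B -> measurable C ->
  mu (B `*` C) = \int[nu]_(s in B) phi s C.

Let joint : {measure set (S * A) -> \bar R} :=
  mbind nu (phi \; kdirac (@measurable_id _ (S * A)%type setT)).

Let ge0_integral_joint (f : S * A -> \bar R) : (forall x, 0 <= f x) ->
  measurable_fun setT f ->
  \int[joint]_x f x = \int[nu]_s \int[phi s]_a f (s, a).
Proof.
move=> f0 mf; rewrite ge0_integral_mbind//.
apply: eq_integral => s _; rewrite integral_kcomp//.
by apply: eq_integral => a _; rewrite integral_kdirac.
Qed.

Let jointE D : measurable D -> joint D = mu D.
Proof.
have rect B C : measurable B -> measurable C -> joint (B `*` C) = mu (B `*` C).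
  move=> mB mC; rewrite muE// [RHS]integral_mkcond.
  rewrite -[X in _ X = _]setIT -integral_indic//; last exact: measurableX.
  rewrite ge0_integral_joint//; last first.
    by apply/measurable_EFinP; apply: measurable_indic; exact: measurableX.
  apply: eq_integral => s _; rewrite patchE; case: ifPn => sB.
    rewrite (_ : phi s C = \int[phi s]_a (\1_C a)%:E); last by rewrite integral_indic// setIT.
    apply: eq_integral => a _; congr (_%:E); rewrite !indicE; congr (_%:R); congr nat_of_bool.
    apply/idP/idP; rewrite !inE /=; first by case.
    by move=> Ca; split => //; exact/set_mem.
  apply: integral0_eq => a _; rewrite indicE memNset//= => -[/= Bs _].
  by move/negP : sB; apply; exact/mem_set.
apply: (measure_unique [set B `*` C | B in measurable & C in measurable] (fun=> setT)).
- by rewrite measurable_prod_measurableType.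
- move=> _ _ [X1 mX1 [X2 mX2 <-]] [Y1 mY1 [Y2 mY2 <-]].
  exists (X1 `&` Y1); first exact: measurableI.
  by exists (X2 `&` Y2); [exact: measurableI|rewrite setXI].
- by move=> _; exists setT => //; exists setT => //; rewrite setXTT.
- by rewrite bigcup_const.
- by move=> _ [B mB [C mC <-]]; exact: rect.
- move=> _; rewrite -setXTT rect// muE//.
  under eq_integral do rewrite prob_kernel.
  by rewrite integral_cst// mul1e nu1 ltry.
Qed.

(** Agreement on rectangles identifies [mu] with the law of a pair drawn from [nu] and then [phi],
    for which the formula is integration against a composed kernel. *)
Lemma ge0_integral_disintegration (f : S * A -> \bar R) : (forall x, 0 <= f x) ->
  measurable_fun setT f ->
  \int[mu]_x f x = \int[nu]_s \int[phi s]_a f (s, a).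
Proof.
move=> f0 mf; rewrite -ge0_integral_joint//.
by apply: eq_measure_integral => D mD _; rewrite jointE.
Qed.

End joint_law.

Section kernel_if.
Context d d' (S : measurableType d) (A : measurableType d') (R : realType).
Variables (k1 k2 : R.-pker S ~> A) (D : set S) (mD : measurable D).

Definition kernel_if of measurable D : S -> {measure set A -> \bar R} :=
  fun s => if s \in D then k1 s else k2 s.

Let measurable_kernel_if U : measurable U ->
  measurable_fun setT ((kernel_if mD) ^~ U).
Proof.
move=> mU; rewrite (_ : (kernel_if mD) ^~ U = (fun s => if s \in D then k1 s U else k2 s U)).
  apply: measurable_fun_if => //.
  - rewrite (_ : (fun s => s \in D) = (fun s => (0 < \1_D s :> R)%R)).
      by apply: measurable_fun_ltr => //; exact: measurable_indic.
    by apply/funext => s; rewrite indicE; case: (s \in D); rewrite ?ltr01 ?ltxx.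
  - apply: measurable_funTS; exact: measurable_kernel.
  - apply: measurable_funTS; exact: measurable_kernel.
by apply/funext => s; rewrite /kernel_if; case: ifP.
Qed.

HB.instance Definition _ :=
  isKernel.Build _ _ _ _ _ (kernel_if mD) measurable_kernel_if.

Let kernel_if_setT s : kernel_if mD s setT = 1.
Proof. by rewrite /kernel_if; case: ifP => _; exact: prob_kernel. Qed.

HB.instance Definition _ :=
  Kernel_isProbability.Build _ _ _ _ _ (kernel_if mD) kernel_if_setT.

End kernel_if.

(** * Nonnegative charges as measures *)

Section nonneg_charge.
Context d (T : measurableType d) (R : realType).
Variable mu : {charge set T -> \bar R}.
Hypothesis mu0 : forall B, measurable B -> 0 <= mu B.

(** The negative part lives on the negative set of the Hahn decomposition, where a nonnegative
    charge has both signs and so vanishes. *)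
Lemma cneg_ge0 B : measurable B -> cneg mu B = 0.
Proof.
move=> mB; rewrite /cneg; case: (hahn_sig mu) => -[P N] /= hPN.
have [_ [mN negN] _ _] := hPN.
rewrite jordan_negE cjordan_negE /crestr0 mem_set// /crestr.
have := negN (B `&` N) (measurableI _ _ mB mN) (@subIsetr _ _ _) => le0.
have ge0 := mu0 (measurableI _ _ mB mN).
by rewrite (_ : mu _ = 0) ?oppe0//; apply/eqP; rewrite eq_le le0 ge0.
Qed.

Lemma cpos_ge0 B : measurable B -> cpos mu B = mu B.
Proof.
move=> mB; have := jordan_decomp (svalP (hahn_sig mu)) mB.
have n0 := cneg_ge0 mB; rewrite /cneg in n0.
by move=> ->; rewrite /= /cadd/= /cscale/= n0 mule0 adde0.
Qed.

Lemma cintegral_ge0 D f : measurable D ->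
  cintegral mu D f = \int[cpos mu]_(x in D) f x.
Proof.
move=> mD; rewrite /cintegral [X in _ - X](_ : _ = 0) ?sube0//.
rewrite -(integral_measure_zero D f); apply: eq_measure_integral => B mB _.
exact: cneg_ge0.
Qed.

Lemma cvariation_ge0 B : measurable B -> cvariation mu B = mu B.
Proof.
move=> mB; have n0 := cneg_ge0 mB; have p0 := cpos_ge0 mB.
rewrite -p0 -[RHS]adde0 -n0.
by [].
Qed.

End nonneg_charge.

Lemma lee_real_lt (R : realType) (u v : \bar R) :
  (forall c : R, c%:E < u -> c%:E <= v) -> u <= v.
Proof.
move=> uv; rewrite leNgt; apply/negP => vu.
have [c] : exists c : R, v < c%:E < u.
  case: u v vu uv => [s| |] [t| |] // ts _.
  - exists ((t + s) / 2)%R; rewrite !lte_fin; rewrite lte_fin in ts.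
    by rewrite midf_lt// midf_lt.
  - by exists (s - 1)%R; rewrite ltNyr lte_fin ltrBlDr ltrDl ltr01.
  - by exists (t + 1)%R; rewrite ltry lte_fin ltrDl ltr01.
  - by exists 0%R; rewrite ltry ltNyr.
by move=> /andP[vc /uv]; rewrite leNgt vc.
Qed.

Lemma integral_le0E d (T : measurableType d) (R : realType)
    (m : {measure set T -> \bar R}) (D : set T) (f : T -> R) :
  (forall x, D x -> f x <= 0)%R ->
  \int[m]_(x in D) (f x)%:E = - \int[m]_(x in D) (- f x)%:E.
Proof.
move=> f0; rewrite -integral_ge0N => [|x Dx]; last by rewrite lee_fin oppr_ge0 f0.
by apply: eq_integral => x _; rewrite EFinN oppeK.
Qed.

(** * The linear program *)

Section program.
Context (R : realType) (S A : ptopologicalType).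
Hypothesis (borelS : borel_space R S) (borelA : borel_space R A).
Local Notation SA := (borel S * borel A)%type.
Local Notation H t := (t.-tuple SA * borel S)%type.
Variable feas : S -> set A.
Hypothesis measurable_feas : forall s, measurable (feas s : set (borel A)).
Local Notation K := (graph feas).
Hypothesis closedK : closed K.
Variables (Q : R.-pker SA ~> borel S) (r z : S * A -> R).
Variables (a b : R) (y : R -> \bar R).
Hypothesis r_le0 : forall x, K x -> (r x <= 0)%R.
Hypothesis r_compact : forall eps : R, (0 <= eps)%R ->
  compact [set x : S * A | K x /\ (- eps <= r x)%R].
Hypothesis z_usc : forall x, K x -> forall c : R, (z x < c)%R ->
  \forall x' \near within K (nbhs x), (z x' < c)%R.
Hypothesis Q_weakly_continuous : forall h : S -> R, continuous h ->
  (exists M : R, forall s, (`|h s| <= M)%R) ->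
  {within K, continuous (fun x : S * A => (\int[Q x]_xi h xi)%R)}.
Hypothesis measurable_r : measurable_fun (K : set SA) r.
Hypothesis measurable_z : measurable_fun (K : set SA) z.

Let openM := open_prod_measurable borelS borelA.

Let mK : measurable (K : set SA).
Proof. exact: (closedM openM). Qed.

Let mK1 (B : set S) : measurable (B : set (borel S)) ->
  measurable (K `&` [set x | B x.1] : set SA).
Proof.
move=> mB; apply: measurableI => //.
have := @measurable_fst _ _ (borel S) (borel A) measurableT B mB.
by rewrite setTI.
Qed.

Let hT : hausdorff_space (S * A)%type.
Proof.
exact: (hausdorff_prod (borel_space_hausdorff borelS)
  (borel_space_hausdorff borelA)).
Qed.

Local Notation sf eta := (fun x => shortfall (z x) eta).

Let sf_le0 eta x : (sf eta x <= 0)%R.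
Proof. by rewrite /shortfall ge_min lexx orbT. Qed.

Let measurable_sf eta : measurable_fun (K : set SA) (sf eta).
Proof.
apply: measurable_minr; last exact: measurable_cst.
by apply: measurable_funB => //; exact: measurable_cst.
Qed.

(** For [c >= 0] the shortfall cost exceeds [c] exactly where [z < eta - c], which is the condition
    that upper semicontinuity of [z] propagates to neighbours. *)
Let closed_sf eta c : (0 <= c)%R ->
  closed (K `&` [set x | (- sf eta x <= c)%R]).
Proof.
move=> c0; apply: closed_sublevel => // x Kx.
have E u : (c < - shortfall u eta)%R = (u < eta - c)%R.
  rewrite /shortfall ltrNr gt_min [X in _ || X]ltrNr oppr0.
  by rewrite [(c < 0)%R]ltNge c0 orbF ltrBlDr addrC.
rewrite E => /(z_usc Kx); apply: filterS => x' h.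
by rewrite E.
Qed.

Let closed_r := closed_cost_sublevel hT r_compact.

Let integral_r (m : {measure set SA -> \bar R}) :
  \int[m]_(x in K) (r x)%:E = - \int[m]_(x in K) (- r x)%:E.
Proof. exact: integral_le0E. Qed.

(* Membership of [m] in [M_w] amounts to the lower bound on the integral of
   [r], since [w = 1 - r] and [r <= 0]. *)
Definition admissible (m : {measure set SA -> \bar R}) : Prop :=
  [/\ m setT = 1, m (~` K) = 0,
      forall B : set (borel S), measurable B ->
        m (K `&` [set x | B x.1]) = \int[m]_(x in K) Q x B,
      -oo < \int[m]_(x in K) (r x)%:E
    & forall eta, (a <= eta <= b)%R -> y eta <= \int[m]_(x in K) (sf eta x)%:E].

Lemma admissible_defect m (h : S -> R) : admissible m ->
  measurable_fun [set: borel S] h -> (forall s, 0 <= h s <= 1)%R ->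
  \int[m]_(x in K) (h x.1 + 1 - \int[Q x]_xi h xi)%R%:E = 1.
Proof.
move=> [m1 mC mQ _ _] mh h01.
have h0 s : 0 <= (h s)%:E by rewrite lee_fin; have /andP[] := h01 s.
have mhE : measurable_fun [set: borel S] (EFin \o h) by exact/measurable_EFinP.
have /andP[q0 q1] := integral_kernel01 Q m1 mh h01.
have qfin : \int[m]_x \int[Q x]_s (h s)%:E \is a fin_num.
  by rewrite ge0_fin_numE// (le_lt_trans q1)// ltry.
suff hE : \int[m]_x (h x.1)%:E = \int[m]_x \int[Q x]_xi (h xi)%:E.
  by rewrite -[LHS](addeK _ qfin) integral_defect// hE addeAC subee// add0e.
have mfst : measurable_fun [set: SA] (fst : SA -> borel S) by exact: measurable_fst.
pose push : {measure set (borel S) -> \bar R} :=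
  pushforward m (fst : SA -> borel S).
rewrite -[RHS]ge0_integral_mbind//.
transitivity (\int[push mfst]_s (h s)%:E).
  by rewrite (ge0_integral_pushforward mfst).
apply: eq_measure_integral => B mB _.
have mB' : measurable (fst @^-1` B : set SA).
  by have := mfst measurableT B mB; rewrite setTI.
rewrite [LHS](_ : _ = m (fst @^-1` B))// -(measureI_negligibleC mK mC mB').
rewrite setIC mQ// [RHS](_ : _ = \int[m]_x Q x B)//.
by rewrite ge0_integral_negligible_setC//; exact: measurable_kernel.
Qed.

(** The lower bounds are asked only for reals strictly below [L] and [y eta]: this is what a limit
    inferior provides, and a maximizing sequence satisfies it as well. *)
Lemma admissible_limit (mu : nat -> {measure set SA -> \bar R}) (L : \bar R) :
  (forall n, mu n setT = 1) -> (forall n, mu n (~` K) = 0) ->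
  (forall h : S -> R, continuous h -> (forall s, 0 <= h s <= 1)%R ->
    forall e : R, (0 < e)%R ->
    \forall n \near \oo, \int[mu n]_(x in K) (h x.1 + 1 - \int[Q x]_xi h xi)%R%:E
      <= (1 + e)%:E) ->
  -oo < L ->
  (forall c : R, c%:E < L ->
    \forall n \near \oo, c%:E <= \int[mu n]_(x in K) (r x)%:E) ->
  (forall eta, (a <= eta <= b)%R -> forall c : R, c%:E < y eta ->
    \forall n \near \oo, c%:E <= \int[mu n]_(x in K) (sf eta x)%:E) ->
  exists2 P : probability SA R,
    admissible P & L <= \int[P]_(x in K) (r x)%:E.
Proof.
move=> mu1 muK mu_stationary Loo Lr ysf.
have le (f : S * A -> R) (m : {measure set SA -> \bar R}) c :
    (forall x, K x -> f x <= 0)%R ->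
    (c%:E <= \int[m]_(x in K) (f x)%:E) =
    (\int[m]_(x in K) (- f x)%:E <= (- c)%:E).
  by move=> f0; rewrite integral_le0E// leeNr.
(* Any real below [L] bounds the costs [- r] eventually, which is the source of tightness. *)
have [c0 c0L] : exists c : R, c%:E < L.
  case: L Loo {Lr} => // [l|] _; last by exists 0%R; rewrite ltry.
  by exists (l - 1)%R; rewrite lte_fin ltrBlDr ltrDl ltr01.
have c0r : \forall n \near \oo, \int[mu n]_(x in K) (- r x)%:E <= (- c0)%:E.
  by apply: filterS (Lr _ c0L) => n; rewrite le.
have [P [PK PQ Pg]] := occupation_limit borelS borelA closedK r_le0 r_compact
  Q_weakly_continuous mu1 muK c0r mu_stationary.
have Lr' : L <= \int[P]_(x in K) (r x)%:E.
  apply: lee_real_lt => c cL; rewrite le//; apply: Pg => //.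
    by move=> x Kx; rewrite oppr_ge0 r_le0.
  by apply: filterS (Lr _ cL) => n; rewrite le.
exists P => //; split => //.
- exact: probability_setT.
- exact: lt_le_trans Lr'.
- move=> eta abeta; apply: lee_real_lt => c cy; rewrite le//; apply: Pg => //.
    by move=> x Kx; rewrite oppr_ge0.
  by move=> e; exact: closed_sf.
  by apply: filterS (ysf _ abeta _ cy) => n; rewrite le.
Qed.

Lemma Delta_admissible pi nu : Delta feas Q r z a b y pi nu ->
  exists2 P : probability SA R,
    admissible P & average feas Q r pi nu <= \int[P]_(x in K) (r x)%:E.
Proof.
move=> [policy_pi r_oo ysf].
pose occ n := occupation Q pi nu n.
have near_average (f : S * A -> R) (c : R) : measurable_fun (K : set SA) f ->
    (forall x, K x -> f x <= 0)%R -> c%:E < average feas Q f pi nu ->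
    \forall n \near \oo, c%:E <= \int[occ n]_(x in K) (f x)%:E.
  move=> mf f0 /near_lt_limn_einf[N _ cN]; exists N => // n /= Nn.
  (* [occ n] averages [n + 1] pairs and thus corresponds to the horizon [n.+1]. *)
  have := cN n.+1 (leqW Nn).
  by rewrite (@integral_le0E _ SA _ _ _ _ f0) /= (average_occupation Q measurable_feas mK policy_pi).
apply: (admissible_limit (mu := occ)) => //.
- by move=> n; apply: (occupation_setT _ _); exact: probability_setT.
- by move=> n; exact: (occupation_setC _ measurable_feas mK policy_pi).
- move=> h ch h01 e e0; near=> n.
  apply: (@le_trans _ _ (1 + n.+1%:R^-1)%:E).
    exact: (occupation_stationary Q measurable_feas mK policy_pi
      (probability_setT nu) n (continuous_borel ch) h01).
  rewrite lee_fin lerD2l ltW//; near: n; exact: near_infty_natSinv_lt (PosNum e0).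
- move=> c; exact: near_average.
- move=> eta abeta c cy; apply: near_average => //.
  exact: lt_le_trans (ysf _ abeta).
Unshelve. all: by end_near. Qed.

Lemma admissible_maximizer m0 : admissible m0 ->
  exists2 P : probability SA R, admissible P &
    forall m, admissible m ->
      \int[m]_(x in K) (r x)%:E <= \int[P]_(x in K) (r x)%:E.
Proof.
move=> m0_adm.
pose L := ereal_sup [set \int[m]_(x in K) (r x)%:E | m in admissible].
have leL m : admissible m -> \int[m]_(x in K) (r x)%:E <= L.
  by move=> m_adm; apply: ereal_sup_ubound; exists m.
have Loo : -oo < L.
  by have [_ _ _ m0r _] := m0_adm; exact: lt_le_trans m0r (leL _ m0_adm).
have L0 : L <= 0.
  apply: ge_ereal_sup => _ [m _ <-]; rewrite integral_r leeNl oppe0.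
  by apply: integral_ge0 => x Kx; rewrite lee_fin oppr_ge0 r_le0.
have Lfin : L \is a fin_num by rewrite fin_numElt Loo (le_lt_trans L0)// ltry.
have [mu muP] : {mu : nat -> {measure set SA -> \bar R} & forall n,
    admissible (mu n) /\ L - (n.+1%:R^-1)%:E < \int[mu n]_(x in K) (r x)%:E}.
  apply: (@choice _ _ (fun n m => admissible m /\
    L - (n.+1%:R^-1)%:E < \int[m]_(x in K) (r x)%:E)) => n.
  have n0 : (0 < n.+1%:R^-1 :> R)%R by rewrite invr_gt0.
  by have [_ [m ? <-] ?] := ub_ereal_sup_adherent n0 Lfin; exists m.
have [||||||P P_adm LP] := @admissible_limit mu L.
- by move=> n; have [[]] := muP n.
- by move=> n; have [[]] := muP n.
- move=> h ch h01 e e0; apply: nearW => n.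
  have [mn _] := muP n.
  rewrite (admissible_defect mn (continuous_borel ch) h01).
  by rewrite lee_fin lerDl ltW.
- by [].
- move=> c cL.
  have e0 : (0 < fine L - c)%R by rewrite subr_gt0 -lte_fin fineK.
  near=> n; have [_ /ltW] := muP n; apply: le_trans.
  rewrite -(fineK Lfin) -EFinB lee_fin lerBrDl -lerBrDr ltW//.
  near: n; exact: near_infty_natSinv_lt (PosNum e0).
- move=> eta abeta c cy; apply: nearW => n.
  by have [[_ _ _ _ /(_ _ abeta) h] _] := muP n; exact: le_trans (ltW cy) h.
by exists P => // m m_adm; exact: le_trans (leL _ m_adm) LP.
Unshelve. all: by end_near. Qed.

Section stationary_policies.
Variables (m : {measure set SA -> \bar R}) (nu : probability (borel S) R).
Variable phi : R.-pker borel S ~> borel A.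
Hypothesis m_adm : admissible m.
Hypothesis phi_stationary : stationary_policy feas phi.
Hypothesis nuE : forall B : set (borel S), measurable B ->
  nu B = m (K `&` [set x | B x.1]).
Hypothesis mE : forall (B : set (borel S)) (C : set (borel A)),
  measurable B -> measurable C ->
  m (K `&` (B `*` C)) = \int[nu]_(s in B) phi s C.
Local Notation pi := (policy_of_stationary phi).

Let policy_pi : policy feas pi.
Proof. by move=> t h _; exact: phi_stationary. Qed.

Lemma average_stationary (f : S * A -> R) :
  measurable_fun (K : set SA) f -> (forall x, K x -> f x <= 0)%R ->
  average feas Q f pi nu = \int[m]_(x in K) (f x)%:E.
Proof.
move=> mf f0; have [m1 mC mQ _ _] := m_adm.
pose g : SA -> \bar R := (fun x => (- f x)%:E) \_ K.
have g0 x : 0 <= g x.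
  by rewrite /g patchE; case: ifPn => // /set_mem Kx; rewrite lee_fin oppr_ge0 f0.
have mg : measurable_fun setT g.
  apply/(measurable_restrictT _ _).1 => //.
  by apply/measurable_EFinP; exact: measurable_funN.
have muE (F : SA -> \bar R) : (forall x, 0 <= F x) -> measurable_fun setT F ->
    \int[m]_x F x = \int[nu]_s \int[phi s]_a F (s, a).
  move=> F0 mF; apply: ge0_integral_disintegration => // [|B C mB mC'].
    exact: probability_setT.
  by rewrite -mE// setIC; apply/esym/(measureI_negligibleC mK mC); exact: measurableX.
have muQ (B : set (borel S)) : measurable B -> \int[m]_x Q x B = nu B.
  move=> mB; rewrite nuE// mQ// (ge0_integral_negligible_setC mK mC)//.
  exact: measurable_kernel.
have pairE t : \int[pair_law Q pi nu t]_(x in K) (- f x)%:E =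
    \int[m]_(x in K) (- f x)%:E.
  rewrite integral_mkcond [RHS]integral_mkcond.
  exact: (pair_law_invariant muE muQ).
(* The sequence is constant only from [T = 1] on: at [T = 0] the factor [T^-1] is 0. *)
apply: (cvg_limn_einf_sup _).1; apply: cvg_near_cst; exists 1%N => // -[//|n] _ /=.
rewrite (average_occupation Q measurable_feas mK policy_pi)//.
rewrite (@integral_le0E _ SA _ _ _ _ f0); congr (- _).
rewrite integral_occupation//; last 2 first.
- by move=> x Kx; rewrite lee_fin oppr_ge0 f0.
- by apply/measurable_EFinP; exact: measurable_funN.
rewrite (eq_bigr (fun=> 1%:E * \int[m]_(x in K) (- f x)%:E)); last first.
  by move=> t _; rewrite mul1e; exact: pairE.
rewrite -ge0_sume_distrl; last by move=> *; rewrite lee_fin.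
by rewrite sumEFin sumr_const card_ord muleA -EFinM mulVf// mul1e.
Qed.

Lemma Delta_stationary : Delta feas Q r z a b y pi nu.
Proof.
have [_ _ _ rm ym] := m_adm; split => //.
  by rewrite average_stationary.
by move=> eta abeta; rewrite average_stationary//; exact: ym.
Qed.

End stationary_policies.

Section linear_program.
Local Notation lp_feasible := (lp_feasible feas Q r z a b y).

Lemma pairing_cpos (mu : {charge set SA -> \bar R}) f :
  (forall B : set SA, measurable B -> 0 <= mu B) ->
  pairing feas mu f = \int[cpos mu]_(x in K) f x.
Proof. by move=> mu0; exact: cintegral_ge0. Qed.

Lemma lp_feasible_cpos (mu : {charge set SA -> \bar R}) :
  lp_feasible mu -> admissible (cpos mu).
Proof.
move=> [[muK muw] [L0E mu1 yL1 mu0]].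
have muKC : cpos mu (~` K) = 0.
  rewrite cpos_ge0//; last exact: measurableC.
  by rewrite -cvariation_ge0//; exact: measurableC.
split => //.
- rewrite -(measureI_negligibleC mK muKC measurableT) setTI.
  by rewrite -mu1 pairing_cpos// integral_cst// mul1e.
- move=> B mB; have := L0E B mB.
  rewrite /L0 pairing_cpos// /marginal -cpos_ge0//; last exact: mK1.
  (* As the first term is finite, a zero difference of extended reals forces equality. *)
  have : cpos mu (K `&` [set x | B x.1]) \is a fin_num.
    by rewrite cpos_ge0; [exact: fin_num_measure (mK1 mB)|exact: mu0|exact: mK1].
  case: (cpos mu _) => // p _; case: (integral _ _ _) => // q /eqP.
  by rewrite -EFinB eqe subr_eq0 => /eqP ->.
- have mr : measurable_fun (K : set SA) (fun x => (- r x)%:E).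
    by apply/measurable_EFinP; exact: measurable_funN.
  rewrite (@integral_le0E _ SA _ _ _ _ r_le0) lteNr/=.
  apply: le_lt_trans muw.
  rewrite [leRHS](@eq_measure_integral _ _ _ _ (cpos mu)); last first.
    by move=> B mB _; rewrite cpos_ge0//; exact: cvariation_ge0.
  apply: ge0_le_integral => //.
  + by move=> x Kx; rewrite lee_fin oppr_ge0 r_le0.
  + by apply/measurable_EFinP; apply: measurable_funB.
  + by move=> x Kx; rewrite lee_fin /w lerBrDr addNr ler01.
- by move=> eta abeta; rewrite -pairing_cpos//; exact: yL1.
Qed.

Lemma lp_objective_cpos (mu : {charge set SA -> \bar R}) :
  lp_feasible mu -> lp_objective feas r mu = \int[cpos mu]_(x in K) (r x)%:E.
Proof. by move=> [_ [_ _ _ mu0]]; exact: pairing_cpos. Qed.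

Lemma admissible_charge (P : probability SA R) : admissible P ->
  lp_feasible (charge_of_finite_measure P) /\
  lp_objective feas r (charge_of_finite_measure P) = \int[P]_(x in K) (r x)%:E.
Proof.
move=> [P1 PK PQ Pr yP]; set mu := charge_of_finite_measure P.
have mu0 B : measurable B -> 0 <= mu B by move=> mB; exact: measure_ge0.
have pairE f : pairing feas mu f = \int[P]_(x in K) f x.
  rewrite pairing_cpos//; apply: eq_measure_integral => B mB _.
  exact: cpos_ge0.
split; last exact: pairE.
split; first split.
- by rewrite cvariation_ge0//; exact: measurableC.
- rewrite (@eq_measure_integral _ _ _ _ P); last first.
    by move=> B mB _; exact: cvariation_ge0.
  have mr : measurable_fun (K : set SA) (fun x => (- r x)%:E).
    by apply/measurable_EFinP; exact: measurable_funN.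
  have r0 x : K x -> 0 <= (- r x)%:E.
    by move=> Kx; rewrite lee_fin oppr_ge0 r_le0.
  rewrite /w; under eq_integral do rewrite EFinD.
  rewrite ge0_integralD// integral_cst// mul1e lte_add_pinfty//.
    by rewrite (le_lt_trans (probability_le1 P mK))// ltry.
  by move: Pr; rewrite (@integral_le0E _ SA _ _ _ _ r_le0) lteNr.
split => //.
- move=> B mB; rewrite /L0 pairE /marginal.
  rewrite [X in X - _](_ : _ = P (K `&` [set x | B x.1]))// PQ// subee//.
  by rewrite -PQ//; exact: fin_num_measure (mK1 mB).
- rewrite pairE integral_cst// mul1e -P1.
  by rewrite -(measureI_negligibleC mK PK measurableT) setTI.
- by move=> eta abeta; rewrite /L1 pairE; exact: yP.
Qed.

End linear_program.

End program.

Section disintegration.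
Context (R : realType) (S A : ptopologicalType).
Hypothesis borelA : borel_space R A.
Local Notation SA := (borel S * borel A)%type.
Variable feas : S -> set A.
Hypothesis measurable_feas : forall s, measurable (feas s : set (borel A)).
Local Notation K := (graph feas).
Hypothesis mK : measurable (K : set SA).
Variable phi0 : R.-pker borel S ~> borel A.
Hypothesis phi0_stationary : stationary_policy feas phi0.
Variable m : {measure set SA -> \bar R}.
Hypotheses (m1 : m setT = 1) (mC : m (~` K) = 0).

(* The conditional kernel is concentrated on [feas s] only for [nu]-almost all [s];
   [phi0] replaces it on the exceptional set. *)
Lemma stationary_disintegration :
  exists (nu : probability (borel S) R) (phi : R.-pker borel S ~> borel A),
  [/\ stationary_policy feas phi,
      forall B : set (borel S), measurable B -> nu B = m (K `&` [set x | B x.1])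
    & forall (B : set (borel S)) (C : set (borel A)),
        measurable B -> measurable C ->
        m (K `&` (B `*` C)) = \int[nu]_(s in B) phi s C].
Proof.
have mfst : measurable_fun [set: SA] (fst : SA -> borel S) by exact: measurable_fst.
pose push0 : {measure set (borel S) -> \bar R} :=
  pushforward m (fst : SA -> borel S).
pose push : {measure set (borel S) -> \bar R} := push0 mfst.
have push1 : push setT = 1 by rewrite [LHS](_ : _ = m (fst @^-1` setT)).
pose nu : probability (borel S) R := mprobability push1.
have nuE B : measurable B -> nu B = m (B `*` setT).
  by move=> mB; rewrite [LHS](_ : _ = m (fst @^-1` B))// setXT.
have [f [h [mf mh fK]]] := borel_space_coding borelA.
have [k kE] := conditional_kernel_exists mf mh fK nuE.
pose F s := k s (feas s).
have mF : measurable_fun setT F.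
  have := measurable_fun_xsection_finite_kernel k (mem_set mK).
  rewrite (_ : (fun s => _) = F)//; apply/funext => s.
  rewrite /F/=; congr (k s _).
  by apply/seteqP; split => x; rewrite /xsection/= inE.
pose D : set (borel S) := F @^-1` [set 1].
have mD : measurable D.
  by rewrite -[D]setTI; exact: mF.
(* [G s] is the mass that [k s] puts outside [feas s]; its integral against [nu] is the mass that
   [m] gives to the complement of [K], which is 0. *)
have nuD : {ae nu, forall s, D s}.
  pose G s := \int[k s]_x (\1_(~` K) ((s, x) : SA))%:E : \bar R.
  have mI : measurable_fun [set: SA] (fun x => (\1_(~` K) x)%:E : \bar R).
    by apply/measurable_EFinP; apply: measurable_indic; exact: measurableC.
  have FG s : G s = 0 -> F s = 1.
    rewrite /G (_ : \int[k s]_x _ = k s (~` feas s)) => [ks0|].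
      transitivity (k s (feas s) + k s (~` feas s)); first by rewrite ks0 adde0.
      rewrite -measureU//; first by rewrite setUv; exact: prob_kernel.
      + exact: measurableC.
      + exact: setICr.
    transitivity (\int[k s]_x (\1_(~` feas s) x)%:E); last first.
      by rewrite integral_indic ?setIT//; exact: measurableC.
    apply: eq_integral => x _; rewrite !indicE.
    by rewrite (_ : (_ \in ~` K) = (x \in ~` feas s)).
  have G0 s : 0 <= G s by apply: integral_ge0 => x _; rewrite lee_fin.
  have mG : measurable_fun setT G.
    apply: (measurable_fun_integral_finite_kernel (fun x => (\1_(~` K) (x : SA))%:E)).
      by move=> x; rewrite lee_fin.
    exact: mI.
  have : \int[nu]_s `|G s| = 0.
    under eq_integral do rewrite gee0_abs//.
    rewrite -(@ge0_integral_disintegration _ _ _ _ _ k nu m _ kE (fun x => (\1_(~` K) (x : SA))%:E))//.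
    + by rewrite integral_indic// ?setIT//; exact: measurableC.
  move/(ae_eq_integral_abs _ measurableT mG); apply: filterS => s /(_ I).
  exact: FG.
pose phi : R.-pker borel S ~> borel A := kernel_if k phi0 mD.
exists nu, phi; split.
- move=> s; rewrite [LHS](_ : _ = kernel_if k phi0 mD s (feas s))// /kernel_if.
  by case: ifP => [/set_mem//|_]; exact: phi0_stationary.
- move=> B mB; rewrite nuE// -(measureI_negligibleC mK mC); last exact: measurableX.
  by rewrite setIC setXT.
- move=> B C mB mC'; rewrite setIC (measureI_negligibleC mK mC) ?kE//; last exact: measurableX.
  apply: ae_eq_integral => //.
  + by apply: measurable_funTS; exact: measurable_kernel.
  + by apply: measurable_funTS; exact: measurable_kernel.
  apply: filterS nuD => s Ds _.
  by rewrite [RHS](_ : _ = kernel_if k phi0 mD s C)// /kernel_if mem_set.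
Qed.

End disintegration.

Theorem mainTheorem1 (R : realType)
    (* state and action spaces, feasible actions *)
    (S A : ptopologicalType)
    (borelS : borel_space R S) (borelA : borel_space R A)
    (feas : S -> set A)
    (measurable_feas : forall s, measurable (feas s : set (borel A)))
    (closedK : closed (graph feas))
    (* transition law, reward, constrained function *)
    (Q : R.-pker (borel S * borel A)%type ~> borel S)
    (r z : S * A -> R)
    (measurable_r :
      measurable_fun (graph feas : set (borel S * borel A)%type) r)
    (measurable_z :
      measurable_fun (graph feas : set (borel S * borel A)%type) z)
    (* reference random variable *)
    (d : measure_display) (Omega : measurableType d) (P : probability Omega R)
    (Y : {RV P >-> R}) (a b : R)
    (supportY : P (Y @^-1` `[a, b]%classic) = 1)
    (* standing assumptions (1)-(6) *)
    (Delta_nonempty :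
      exists pi nu, Delta feas Q r z a b (benchmark P Y) pi nu)
    (r_le0 : forall x, graph feas x -> (r x <= 0)%R)
    (r_compact : forall eps : R, (0 <= eps)%R ->
      compact [set x : S * A | graph feas x /\ (- eps <= r x)%R])
    (z_bounded : exists M : R, forall x, graph feas x -> (`|z x| <= M)%R)
    (z_usc : forall x, graph feas x -> forall c : R, (z x < c)%R ->
      \forall x' \near within (graph feas) (nbhs x), (z x' < c)%R)
    (Q_weakly_continuous : forall h : S -> R, continuous h ->
      (exists M : R, forall s, (`|h s| <= M)%R) ->
      {within graph feas, continuous
        (fun x : S * A => (\int[Q x]_xi h xi)%R)} /\
      exists M : R, forall x, graph feas x -> (`|\int[Q x]_xi h xi| <= M)%R)
    (shortfall_F_w : forall eta : R, (a <= eta <= b)%R ->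
      F_w feas r (fun x => (shortfall (z x) eta)%:E))
    (Q_F_w : F_w feas r (fun x => \int[Q x]_xi (w_hat feas r xi)%:E)) :
  let y := benchmark P Y in
  let R_avg := average feas Q r in
  let rho := rho_star feas Q r z a b y in
  [/\ (* both problems have the value rho and attain it *)
      lp_value feas Q r z a b y = rho,
      (exists mu, lp_optimal feas Q r z a b y mu /\ lp_objective feas r mu = rho),
      (exists pi nu, sd_optimal feas Q r z a b y pi nu /\ R_avg pi nu = rho),
      (* a feasible mu disintegrates and yields a feasible pair of equal value *)
      (forall mu, lp_feasible feas Q r z a b y mu ->
        (exists nu phi, disintegration feas mu nu phi) /\
        forall nu phi, disintegration feas mu nu phi ->
          Delta feas Q r z a b y (policy_of_stationary phi) nu /\
          R_avg (policy_of_stationary phi) nu = lp_objective feas r mu)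
    & (* an optimal mu yields an optimal pair *)
      (forall mu, lp_optimal feas Q r z a b y mu ->
        forall nu phi, disintegration feas mu nu phi ->
          sd_optimal feas Q r z a b y (policy_of_stationary phi) nu /\
          R_avg (policy_of_stationary phi) nu = rho)].

Proof.
move=> y R_avg rho.
have mK : measurable (graph feas : set (borel S * borel A)%type).
  exact: (closedM (open_prod_measurable borelS borelA)).
have Q_cont (h : S -> R) : continuous h ->
    (exists M : R, forall s, (`|h s| <= M)%R) ->
    {within graph feas, continuous (fun x : S * A => (\int[Q x]_xi h xi)%R)}.
  by move=> ch hM; have [] := Q_weakly_continuous h ch hM.
pose adm := admissible feas Q r z a b y.
pose lpf := lp_feasible feas Q r z a b y.
have avg_le pi nu : Delta feas Q r z a b y pi nu ->
    exists2 M : probability (borel S * borel A)%type R, adm M &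
      average feas Q r pi nu <= \int[M]_(x in graph feas) (r x)%:E.
  exact: (Delta_admissible borelS borelA measurable_feas closedK r_le0
    r_compact z_usc Q_cont measurable_r measurable_z).
have lp_adm mu : lpf mu -> adm (cpos mu).
  exact: (lp_feasible_cpos borelS borelA closedK r_le0 measurable_r).
have adm_lp (M : probability (borel S * borel A)%type R) : adm M ->
    lpf (charge_of_finite_measure M) /\
    lp_objective feas r (charge_of_finite_measure M) =
      \int[M]_(x in graph feas) (r x)%:E.
  exact: (admissible_charge borelS borelA closedK r_le0 measurable_r).
have objE mu : lpf mu ->
    lp_objective feas r mu = \int[cpos mu]_(x in graph feas) (r x)%:E.
  exact: (lp_objective_cpos borelS borelA closedK).
have [pi0 [nu0 Delta0]] := Delta_nonempty.
(* The time-0 kernel of a policy in [Delta] sees only the state and is concentrated on feasible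
   actions at every state: it is the stationary policy needed on exceptional states. *)
pose phi0 : R.-pker borel S ~> borel A :=
  kprecomp (pi0 0%N) (@measurable_hist0 S A).
have phi0_stationary : stationary_policy feas phi0.
  move=> s; have [policy0 _ _] := Delta0.
  have h0 : histories feas (hist0 A (s : borel S)) by case.
  by rewrite [LHS](_ : _ = pi0 0%N (hist0 A (s : borel S)) (feas s))// policy0.
have disint mu : lpf mu -> exists nu phi, disintegration feas mu nu phi.
  move=> mu_lp; have [m1 mC _ _ _] := lp_adm _ mu_lp.
  have [_ [_ _ _ mu0]] := mu_lp.
  have [nu [phi [phi_st nuE mE]]] :=
    stationary_disintegration borelA measurable_feas mK phi0_stationary m1 mC.
  exists nu, phi; split => //.
  - move=> B mB; rewrite nuE//; apply: cpos_ge0 => //.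
    apply: measurableI => //.
    have := @measurable_fst _ _ (borel S) (borel A) measurableT B mB.
    by rewrite setTI.
  - move=> B C mB mC'; rewrite -mE//; apply/esym/cpos_ge0 => //.
    by apply: measurableI => //; exact: measurableX.
have stat mu nu phi : lpf mu -> disintegration feas mu nu phi ->
    Delta feas Q r z a b y (policy_of_stationary phi) nu /\
    R_avg (policy_of_stationary phi) nu = lp_objective feas r mu.
  move=> mu_lp [phi_st nuE mE]; have mu_adm := lp_adm _ mu_lp.
  have [_ [_ _ _ mu0]] := mu_lp.
  have nuE' (B : set (borel S)) : measurable B ->
      nu B = cpos mu (graph feas `&` [set x | B x.1]).
    move=> mB; rewrite nuE// /marginal cpos_ge0//; apply: measurableI => //.
    have := @measurable_fst _ _ (borel S) (borel A) measurableT B mB.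
    by rewrite setTI.
  have mE' (B : set (borel S)) (C : set (borel A)) : measurable B -> measurable C ->
      cpos mu (graph feas `&` (B `*` C)) = \int[nu]_(s in B) phi s C.
    move=> mB mC; rewrite -mE// cpos_ge0//; apply: measurableI => //.
    exact: measurableX.
  split.
    exact: (Delta_stationary borelS borelA measurable_feas closedK r_le0
      measurable_r measurable_z mu_adm phi_st nuE' mE').
  rewrite objE// /R_avg.
  exact: (average_stationary borelS borelA measurable_feas closedK mu_adm phi_st
    nuE' mE' measurable_r r_le0).
have [M M_adm M_max] : exists2 M : probability (borel S * borel A)%type R, adm M &
    forall m, adm m -> \int[m]_(x in graph feas) (r x)%:E <=
      \int[M]_(x in graph feas) (r x)%:E.
  have [M0 M0_adm _] := avg_le _ _ Delta0.
  exact: (admissible_maximizer borelS borelA closedK r_le0 r_compact z_usc Q_cont M0_adm).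
have [lpP objP] := adm_lp _ M_adm.
(* [v] bounds both problems: feasible charges are admissible measures, and a pair in [Delta] is
   dominated by one. The maximizer and its disintegration attain [v] in the respective problems. *)
set v := \int[M]_(x in graph feas) (r x)%:E in M_max objP.
have lp_le mu : lpf mu -> lp_objective feas r mu <= v.
  by move=> mu_lp; rewrite objE//; exact: M_max (lp_adm _ mu_lp).
have avg_le_v pi nu : Delta feas Q r z a b y pi nu -> average feas Q r pi nu <= v.
  by move=> /avg_le[M' /M_max M'v]; move=> /le_trans; apply.
have [nuP [phiP disP]] := disint _ lpP.
have [DP avgP] := stat _ _ _ lpP disP.
have lp_valueE : lp_value feas Q r z a b y = v.
  apply/eqP; rewrite eq_le; apply/andP; split.
    by apply: ge_ereal_sup => _ [mu mu_lp <-]; exact: lp_le.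
  by apply: ereal_sup_ubound; exists (charge_of_finite_measure M).
have rhoE : rho = v.
  apply/eqP; rewrite eq_le; apply/andP; split.
    by apply: ge_ereal_sup => _ [pi [nu [D ->]]]; exact: avg_le_v.
  apply: ereal_sup_ubound; exists (policy_of_stationary phiP), nuP; split => //.
  by rewrite -objP.
split.
- by rewrite rhoE.
- exists (charge_of_finite_measure M); split; last by rewrite rhoE.
  by split => // mu /lp_le; rewrite objP.
- exists (policy_of_stationary phiP), nuP; split; last by rewrite avgP objP rhoE.
  split; first exact: DP.
  move=> pi nu D; apply: le_trans (avg_le_v _ _ D) _.
  rewrite -objP -avgP.
  exact: lexx.
- move=> mu mu_lp; split; first exact: disint.
  by move=> nu phi; exact: stat.
- move=> mu [mu_lp mu_max] nu phi dis; have [D avgE] := stat _ _ _ mu_lp dis.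
  have muv : lp_objective feas r mu = v.
    by apply/eqP; rewrite eq_le lp_le//= -objP; exact: mu_max.
  split; last by rewrite avgE muv rhoE.
  split; first exact: D.
  move=> pi nu' D'; apply: le_trans (avg_le_v _ _ D') _.
  by rewrite -muv -avgE.
Qed.
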